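(* Let $\mathcal{G}$ be an étale groupoid, let $\mathcal{B}=\{\mathcal{B}_\gamma\}_{\gamma\in\mathcal{G}}$ be a Fell bundle over $\mathcal{G}$, let $S\subseteq S(\mathcal{G})$ be a wide inverse subsemigroup of the inverse semigroup of bissections of $\mathcal{G}$, and let $\mathcal{A}=\{C_0(\mathcal{B}_U)\}_{U\in S}$ be the associated Fell bundle over $S$, with sub-bundle $\mathcal{A}^0=\{C_c(\mathcal{B}_U)\}_{U\in S}$. Suppose that either $\mathcal{G}$ is Hausdorff, or $\mathcal{G}$ is second countable and the section spaces $C_0(\mathcal{B}_U)$ are separable for all $U\in S$. Then the canonical map $\Psi\colon C_c(\mathcal{A}^0)\to C_c(\mathcal{B})$ defined by $$\Psi\Big(\sum_{U\in F}\xi_U\delta_U\Big)=\sum_{U\in F}\xi_U$$ for $F\subseteq S$ finite and $\xi_U\in C_c(\mathcal{B}_U)$ for all $U\in F$, induces an isomorphism of $C^*$-algebras $C^*(\mathcal{A})\cong C^*(\mathcal{B})$.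
   Context: Étale groupoid: a topological groupoid $\mathcal{G}$ (not necessarily Hausdorff, with continuous multiplication and inversion) whose unit space $\mathcal{G}^{(0)}$ is locally compact Hausdorff in the relative topology and whose range and source maps $\mathrm{r},\mathrm{d}\colon\mathcal{G}\to\mathcal{G}^{(0)}$ are local homeomorphisms. $\mathcal{G}^{(2)}$ denotes the composable pairs. Banach bundle: an upper-semicontinuous (usc) Banach bundle over a (not necessarily Hausdorff) space $X$ is a topological space $\mathcal{B}$ with a continuous open surjection $p\colon\mathcal{B}\to X$ whose fibers $\mathcal{B}_x=p^{-1}(x)$ are complex Banach spaces such that: $v\mapsto\|v\|$ is usc; addition is continuous on $\{(v,w):p(v)=p(w)\}$; for each $\lambda\in\mathbb{C}$, $v\mapsto\lambda v$ is continuous; and if $p(v_i)\to x$ and $\|v_i\|\to0$ for a net $(v_i)$, then $v_i\to0_x$. Fell bundle over $\mathcal{G}$: a usc Banach bundle $\mathcal{B}=\{\mathcal{B}_\gamma\}_{\gamma\in\mathcal{G}}$ with a continuous associative multiplication defined on $\{(a,b)\in\mathcal{B}\times\mathcal{B}:(p(a),p(b))\in\mathcal{G}^{(2)}\}$, restricting to bilinear maps $\mathcal{B}_{\gamma_1}\times\mathcal{B}_{\gamma_2}\to\mathcal{B}_{\gamma_1\gamma_2}$, and a continuous involution restricting to conjugate-linear maps $\mathcal{B}_\gamma\to\mathcal{B}_{\gamma^{-1}}$, such that $\|ab\|\le\|a\|\|b\|$, $(a^* )^*=a$, $\|a^*\|=\|a\|$, $(ab)^*=b^*a^*$, $\|a^*a\|=\|a\|^2$,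 and $a^*a$ is positive in the $C^*$-algebra $\mathcal{B}_{\mathrm{d}(\gamma)}$ for $a\in\mathcal{B}_\gamma$. Bissections: an open $U\subseteq\mathcal{G}$ is a bissection if $\mathrm{d}|_U\colon U\to\mathrm{d}(U)$ and $\mathrm{r}|_U\colon U\to\mathrm{r}(U)$ are homeomorphisms. $S(\mathcal{G})$ is the inverse semigroup of all bissections, with product $UV=\{\gamma_1\gamma_2:\gamma_1\in U,\gamma_2\in V,\mathrm{d}(\gamma_1)=\mathrm{r}(\gamma_2)\}$, $U^*=\{\gamma^{-1}:\gamma\in U\}$, and order $U\le V\iff U\subseteq V$. An inverse subsemigroup $S\subseteq S(\mathcal{G})$ is wide if (i) $\mathcal{G}=\bigcup_{U\in S}U$, and (ii) for all $U,V\in S$ and $\gamma\in U\cap V$ there is $W\in S$ with $\gamma\in W\subseteq U\cap V$. Associated bundle: $C_0(\mathcal{B}_U)$ (resp. $C_c(\mathcal{B}_U)$) is the space of continuous sections of $\mathcal{B}|_U$ vanishing at infinity (resp. with compact support), with sup norm. $\mathcal{A}=\{C_0(\mathcal{B}_U)\}_{U\in S}$ is a Fell bundle over $S$ with product $(\xi\cdot\eta)(\gamma)=\xi(\gamma_1)\eta(\gamma_2)$ for $\xi\in C_0(\mathcal{B}_U)$, $\eta\in C_0(\mathcal{B}_V)$, where $\gamma\in UV$ is written uniquely as $\gamma=\gamma_1\gamma_2$ with $\gamma_1\in U,\gamma_2\in V$; involution $\xi^*(\gamma)=\xi(\gamma^{-1})^*$; and inclusions $j_{V,U}\colon C_0(\mathcal{B}_U)\to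 C_0(\mathcal{B}_V)$ for $U\subseteq V$ given by extension by zero. $C^*(\mathcal{A})$: $C_c(\mathcal{A})$ is the $*$-algebra of finite formal sums $\sum\xi_U\delta_U$, $\xi_U\in\mathcal{A}_U$, with $(\xi\delta_U)(\eta\delta_V)=(\xi\cdot\eta)\delta_{UV}$, $(\xi\delta_U)^*=\xi^*\delta_{U^*}$; $\mathcal{I}_\mathcal{A}$ is the ideal spanned by all $\xi\delta_U-j_{V,U}(\xi)\delta_V$ with $U\subseteq V$; $C^*(\mathcal{A})$ is the enveloping $C^*$-algebra of $C_c(\mathcal{A})/\mathcal{I}_\mathcal{A}$. $C_c(\mathcal{A}^0)$ is the $*$-subalgebra of sums with $\xi_U\in C_c(\mathcal{B}_U)$; $C^*(\mathcal{A})$ is also the enveloping $C^*$-algebra of the quotient of $C_c(\mathcal{A}^0)$ by the span of $\xi\delta_U-j_{V,U}(\xi)\delta_V$ with $\xi\in C_c(\mathcal{B}_U)$, $U\subseteq V$ in $S$. $C^*(\mathcal{B})$: $C_c(\mathcal{B})$ is the space of sections of $\mathcal{B}$ that are finite sums of sections $\xi_i$, each a continuous compactly supported local section over a Hausdorff open subset $U_i\subseteq\mathcal{G}$ extended by zero to $\mathcal{G}$; it is a $*$-algebra with $(\xi*\eta)(\gamma)=\sum_{\gamma=\gamma_1\gamma_2}\xi(\gamma_1)\eta(\gamma_2)$ and $\xi^*(\gamma)=\xi(\gamma^{-1})^*$. $C^*(\mathcal{B})$ is its enveloping $C^*$-algebra. *)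

(* Defs.v *)
From HB Require Import structures.
From mathcomp Require Import all_boot all_order all_algebra.
From mathcomp.real_closed Require Import complex.
From mathcomp Require Import all_classical all_reals.
From mathcomp Require Import topology normedtype.

Set Implicit Arguments.
Unset Strict Implicit.
Unset Printing Implicit Defensive.

Import Order.TTheory GRing.Theory Num.Theory.
Import numFieldNormedType.Exports.

Local Open Scope classical_set_scope.
Local Open Scope ring_scope.

Definition homeo_on (X Y : topologicalType) (f : X -> Y) (U : set X) : Prop :=
  {within U, continuous f} /\
  exists2 g : Y -> X, {within f @` U, continuous g} &
    forall x, U x -> g (f x) = x.

(* Units are identified with their identity arrows.  The product [gmul x y] is
   only meaningful when [src x = rng y]; its values elsewhere are junk on which
   no axiom depends. *)
Record groupoidData := GroupoidData {
  garr :> topologicalType;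
  src : garr -> garr;
  rng : garr -> garr;
  gmul : garr -> garr -> garr;
  ginv : garr -> garr
}.

Definition units (G : groupoidData) : set G := [set x | src x = x].
Arguments units G : clear implicits.

Definition composable (G : groupoidData) : set (G * G) :=
  [set g | src g.1 = rng g.2].
Arguments composable G : clear implicits.

Definition local_homeo_to_units (G : groupoidData) (f : G -> G) : Prop :=
  forall x : G, exists U : set G,
    [/\ open U, U x, homeo_on f U &
        exists2 V : set G, open V & f @` U = V `&` units G].

Record etaleGroupoid := EtaleGroupoid {
  gdata :> groupoidData;
  src_src : forall x : gdata, src (src x) = src x;
  rng_src : forall x : gdata, rng (src x) = src x;
  src_rng : forall x : gdata, src (rng x) = rng x;
  rng_rng : forall x : gdata, rng (rng x) = rng x;
  src_mul : forall x y : gdata, src x = rng y -> src (gmul x y) = src y;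
  rng_mul : forall x y : gdata, src x = rng y -> rng (gmul x y) = rng x;
  gmulA : forall x y z : gdata, src x = rng y -> src y = rng z ->
    gmul x (gmul y z) = gmul (gmul x y) z;
  gmul_src : forall x : gdata, gmul x (src x) = x;
  gmul_rng : forall x : gdata, gmul (rng x) x = x;
  src_inv : forall x : gdata, src (ginv x) = rng x;
  rng_inv : forall x : gdata, rng (ginv x) = src x;
  gmulV : forall x : gdata, gmul x (ginv x) = rng x;
  gmulVl : forall x : gdata, gmul (ginv x) x = src x;
  gmul_continuous :
    {within composable gdata, continuous (fun g => gmul g.1 g.2)};
  ginv_continuous : continuous (@ginv gdata);
  units_hausdorff : hausdorff_space (set_type (units gdata));
  units_locally_compact : locally_compact [set: set_type (units gdata)];
  src_local_homeo : local_homeo_to_units (@src gdata);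
  rng_local_homeo : local_homeo_to_units (@rng gdata)
}.

Section Bissections.
Variable G : etaleGroupoid.
Implicit Types U V W : set G.

Definition bissection U : Prop :=
  [/\ open U, homeo_on (@src G) U & homeo_on (@rng G) U].

Definition bmul U V : set G :=
  [set gmul g.1 g.2 | g in (U `*` V) `&` composable G].

Definition binv U : set G := @ginv G @` U.

Definition inverse_subsemigroup (S : set (set G)) : Prop :=
  [/\ forall U, S U -> bissection U,
      forall U V, S U -> S V -> S (bmul U V) &
      forall U, S U -> S (binv U)].

Definition wide (S : set (set G)) : Prop :=
  (forall x : G, exists2 U, S U & U x) /\
  (forall U V (x : G), S U -> S V -> U x -> V x ->
     exists W, [/\ S W, W x & W `<=` U `&` V]).

End Bissections.

(* The norm of a normed module over R[i] takes its (real) values in R[i]. *)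
Definition rnorm (R : realType) (E : normedModType R[i]) (v : E) : R :=
  complex.Re `|v|.

(* The total space is in bijection with the disjoint union of the fibers
   through [inc] and [vec]. *)
Record bundleData (R : realType) (X : topologicalType) := BundleData {
  fib : X -> completeNormedModType R[i];
  tot : topologicalType;
  proj : tot -> X;
  inc : forall x : X, fib x -> tot;
  vec : forall b : tot, fib (proj b);
  proj_inc : forall x (v : fib x), proj (inc v) = x;
  inc_inj : forall x, injective (@inc x);
  vecK : forall b : tot, inc (vec b) = b
}.
Arguments proj {R X} b0 b : rename.
Arguments inc {R X} b0 {x} v : rename.
Arguments vec {R X} b0 b : rename.

(* The point b of the total space as a vector of the fiber over x, or 0 if b
   does not lie over x. *)
Definition fiber_at (R : realType) (X : topologicalType) (B : bundleData R X)
    (x : X) (b : tot B) : fib B x :=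
  match pselect (proj B b = x) with
  | left e => eq_rect (proj B b) (fib B) (vec B b) x e
  | right _ => 0
  end.

(* Surjectivity of proj follows from [proj_inc], applied to zero vectors.
   Convergence of nets in the total space is expressed through filters. *)
Record banachBundle (R : realType) (X : topologicalType) := BanachBundle {
  bdata :> bundleData R X;
  proj_continuous : continuous (proj bdata);
  proj_open : forall W : set (tot bdata), open W -> open (proj bdata @` W);
  norm_usc : forall e : R, open [set b : tot bdata | rnorm (vec bdata b) < e];
  add_continuous :
    {within [set vw : tot bdata * tot bdata |
               proj bdata vw.1 = proj bdata vw.2],
     continuous (fun vw => inc bdata
       (vec bdata vw.1 + fiber_at (proj bdata vw.1) vw.2))};
  scale_continuous : forall k : R[i],
    continuous (fun b : tot bdata => inc bdata (k *: vec bdata b));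
  null_cvg : forall (x : X) (F : set_system (tot bdata)), ProperFilter F ->
    proj bdata @ F --> x ->
    (fun b => rnorm (vec bdata b)) @ F --> (0 : R) ->
    F --> inc bdata (0 : fib bdata x)
}.

(* A section over an open set U is represented by its extension by zero, so
   that extension by zero from U to a larger set V is the identity. *)
Definition section (R : realType) (X : topologicalType) (B : bundleData R X) :=
  forall x : X, fib B x.

Section SectionLmodule.
Variables (R : realType) (X : topologicalType) (B : bundleData R X).
Implicit Types s t u : section B.

HB.instance Definition _ := gen_eqMixin (section B).
HB.instance Definition _ := gen_choiceMixin (section B).

Let sadd s t : section B := fun x => s x + t x.
Let sopp s : section B := fun x => - s x.
Let szero : section B := fun x => 0.
Let sscale (k : R[i]) s : section B := fun x => k *: s x.

Fact sec_addA : associative sadd.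
Proof. by move=> s t u; apply: functional_extensionality_dep => x; exact: addrA. Qed.
Fact sec_addC : commutative sadd.
Proof. by move=> s t; apply: functional_extensionality_dep => x; exact: addrC. Qed.
Fact sec_add0 : left_id szero sadd.
Proof. by move=> s; apply: functional_extensionality_dep => x; exact: add0r. Qed.
Fact sec_addN : left_inverse szero sopp sadd.
Proof. by move=> s; apply: functional_extensionality_dep => x; exact: addNr. Qed.

HB.instance Definition _ :=
  GRing.isZmodule.Build (section B) sec_addA sec_addC sec_add0 sec_addN.

Fact sec_scaleA (k l : R[i]) s : sscale k (sscale l s) = sscale (k * l) s.
Proof. by apply: functional_extensionality_dep => x; exact: scalerA. Qed.
Fact sec_scale1 : left_id 1 sscale.
Proof. by move=> s; apply: functional_extensionality_dep => x; exact: scale1r. Qed.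
Fact sec_scaleDr : right_distributive sscale +%R.
Proof. by move=> k s t; apply: functional_extensionality_dep => x; exact: scalerDr. Qed.
Fact sec_scaleDl s : {morph (fun k => sscale k s) : k l / k + l >-> k + l}.
Proof. by move=> k l; apply: functional_extensionality_dep => x; exact: scalerDl. Qed.

HB.instance Definition _ := GRing.Zmodule_isLmodule.Build R[i] (section B)
  sec_scaleA sec_scale1 sec_scaleDr sec_scaleDl.

Definition continuous_section_on (U : set X) (s : section B) : Prop :=
  {within U, continuous (fun x => inc B (s x) : tot B)}.

Definition C0sec (U : set X) : set (section B) :=
  [set s | [/\ forall x, ~ U x -> s x = 0,
               continuous_section_on U s &
               forall e : R, 0 < e -> exists K : set X,
                 [/\ compact K, K `<=` U &
                     forall x, U x -> ~ K x -> rnorm (s x) < e]]].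

Definition Ccsec (U : set X) : set (section B) :=
  [set s | [/\ forall x, ~ U x -> s x = 0,
               continuous_section_on U s &
               exists K : set X,
                 [/\ compact K, K `<=` U & forall x, ~ K x -> s x = 0]]].

Definition supnorm (U : set X) (s : section B) : R :=
  sup [set rnorm (s x) | x in U].

Definition C0_separable (U : set X) : Prop :=
  exists D : set (section B),
    [/\ countable D, D `<=` C0sec U &
        forall s, C0sec U s -> forall e : R, 0 < e ->
          exists2 t, D t & supnorm U (s - t) < e].

End SectionLmodule.

(* [fmul] is only meaningful over composable pairs.  Equalities between
   vectors whose fibers are only provably equal are stated in the total space.
   An element of a C*-algebra is positive when it is of the form c^* c. *)
Record fellBundle (R : realType) (G : etaleGroupoid) := FellBundle {
  fbundle :> banachBundle R G;
  fmul : forall x y : G, fib fbundle x -> fib fbundle y ->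
    fib fbundle (gmul x y);
  fstar : forall x : G, fib fbundle x -> fib fbundle (ginv x);
  fmul_continuous :
    {within [set ab : tot fbundle * tot fbundle |
               composable G (proj fbundle ab.1, proj fbundle ab.2)],
     continuous (fun ab => inc fbundle
       (fmul (vec fbundle ab.1) (vec fbundle ab.2)))};
  fstar_continuous :
    continuous (fun a : tot fbundle => inc fbundle (fstar (vec fbundle a)));
  fmulA : forall (x y z : G) (a : fib fbundle x) (b : fib fbundle y)
      (c : fib fbundle z), src x = rng y -> src y = rng z ->
    inc fbundle (fmul a (fmul b c)) = inc fbundle (fmul (fmul a b) c);
  fmul_linearl : forall (x y : G) (k : R[i]) (a a' : fib fbundle x)
      (b : fib fbundle y), src x = rng y ->
    fmul (k *: a + a') b = k *: fmul a b + fmul a' b;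
  fmul_linearr : forall (x y : G) (k : R[i]) (a : fib fbundle x)
      (b b' : fib fbundle y), src x = rng y ->
    fmul a (k *: b + b') = k *: fmul a b + fmul a b';
  fstar_conj_linear : forall (x : G) (k : R[i]) (a a' : fib fbundle x),
    fstar (k *: a + a') = (Num.conj k) *: fstar a + fstar a';
  fmul_norm : forall (x y : G) (a : fib fbundle x) (b : fib fbundle y),
    src x = rng y -> rnorm (fmul a b) <= rnorm a * rnorm b;
  fstarK : forall (x : G) (a : fib fbundle x),
    inc fbundle (fstar (fstar a)) = inc fbundle a;
  fstar_norm : forall (x : G) (a : fib fbundle x),
    rnorm (fstar a) = rnorm a;
  fstarM : forall (x y : G) (a : fib fbundle x) (b : fib fbundle y),
    src x = rng y ->
    inc fbundle (fstar (fmul a b)) = inc fbundle (fmul (fstar b) (fstar a));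
  fcstar : forall (x : G) (a : fib fbundle x),
    rnorm (fmul (fstar a) a) = rnorm a ^+ 2;
  fpositive : forall (x : G) (a : fib fbundle x),
    exists c : fib fbundle (src x),
      inc fbundle (fmul (fstar a) a) = inc fbundle (fmul (fstar c) c)
}.
Arguments fmul {R G} f {x y} a b : rename.
Arguments fstar {R G} f {x} a : rename.

Record cstarAlgebra (R : realType) := CstarAlgebra {
  cs_car :> completeNormedModType R[i];
  cs_mul : cs_car -> cs_car -> cs_car;
  cs_star : cs_car -> cs_car;
  cs_mulA : associative cs_mul;
  cs_linearl : forall (k : R[i]) (a a' b : cs_car),
    cs_mul (k *: a + a') b = k *: cs_mul a b + cs_mul a' b;
  cs_linearr : forall (k : R[i]) (a b b' : cs_car),
    cs_mul a (k *: b + b') = k *: cs_mul a b + cs_mul a b';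
  cs_star_conj_linear : forall (k : R[i]) (a a' : cs_car),
    cs_star (k *: a + a') = (Num.conj k) *: cs_star a + cs_star a';
  cs_starK : involutive cs_star;
  cs_starM : forall a b : cs_car,
    cs_star (cs_mul a b) = cs_mul (cs_star b) (cs_star a);
  cs_mul_norm : forall a b : cs_car, rnorm (cs_mul a b) <= rnorm a * rnorm b;
  cs_cstar : forall a : cs_car, rnorm (cs_mul (cs_star a) a) = rnorm a ^+ 2
}.
Arguments cs_mul {R} c a b : rename.
Arguments cs_star {R} c a : rename.

(* The *-algebra A / I, where A = [sq_sub] is a *-algebra for the operations of
   an ambient vector space, and I = [sq_null] is an ideal of A.  The ambient
   operations need not obey any law outside A.  Functions out of A / I are
   represented by functions on the ambient space, whose values outside A are
   irrelevant. *)
Record starSubquotient (R : realType) := StarSubquotient {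
  sq_car : lmodType R[i];
  sq_mul : sq_car -> sq_car -> sq_car;
  sq_star : sq_car -> sq_car;
  sq_sub : set sq_car;
  sq_null : set sq_car
}.

Section Enveloping.
Variable R : realType.

Definition star_hom (A : starSubquotient R) (D : cstarAlgebra R)
    (phi : sq_car A -> D) : Prop :=
  [/\ forall (k : R[i]) a b, sq_sub a -> sq_sub b ->
        phi (k *: a + b) = k *: phi a + phi b,
      forall a b, sq_sub a -> sq_sub b ->
        phi (sq_mul a b) = cs_mul D (phi a) (phi b),
      forall a, sq_sub a -> phi (sq_star a) = cs_star D (phi a) &
      forall a, sq_null a -> phi a = 0].

Definition cs_hom (D E : cstarAlgebra R) (psi : D -> E) : Prop :=
  [/\ forall (k : R[i]) a b, psi (k *: a + b) = k *: psi a + psi b,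
      forall a b, psi (cs_mul D a b) = cs_mul E (psi a) (psi b) &
      forall a, psi (cs_star D a) = cs_star E (psi a)].

Definition cs_iso (D E : cstarAlgebra R) (psi : D -> E) : Prop :=
  cs_hom psi /\ bijective psi.

(* E is the universal C*-algebra receiving a *-homomorphism from A / I. *)
Definition enveloping (A : starSubquotient R) (E : cstarAlgebra R)
    (iota : sq_car A -> E) : Prop :=
  star_hom iota /\
  forall (D : cstarAlgebra R) (phi : sq_car A -> D), star_hom phi ->
    exists! psi : E -> D,
      cs_hom psi /\ forall a, sq_sub a -> psi (iota a) = phi a.

Definition lspan (V : lmodType R[i]) (X : set V) : set V :=
  [set v | exists (n : nat) (c : 'I_n -> R[i]) (w : 'I_n -> V),
     (forall i, X (w i)) /\ v = \sum_(i < n) c i *: w i].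

End Enveloping.

Section Algebras.
Variables (R : realType) (G : etaleGroupoid) (B : fellBundle R G).
Implicit Types (s t : section B) (U V W : set G).

(* sum of s(g1) t(g2) over the factorizations x = g1 g2 with (g1, g2) in P;
   by convention a [\sum_(_ \in _)] with infinitely many nonzero terms is 0 *)
Definition conv_on (P : set (G * G)) s t : section B :=
  fun x => \sum_(g \in [set g | [/\ P g, composable G g & gmul g.1 g.2 = x]])
    fiber_at x (inc B (fmul B (s g.1) (t g.2))).

Definition sec_star s : section B :=
  fun x => fiber_at x (inc B (fstar B (s (ginv x)))).

(* If U and V are bissections, then x in UV has a unique factorization in
   U x V, and x outside UV has none: the sum has at most one term. *)
Definition sec_mul U V s t : section B := conv_on (U `*` V) s t.

(* f stands for the formal sum of the f(U) delta_U *)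
Local Notation formal := (set G -> section B).

Definition delta U s : formal := fun V => if V == U then s else 0.

Definition formal_mul (f g : formal) : formal :=
  fun W => \sum_(UV \in [set UV : set G * set G | bmul UV.1 UV.2 = W])
    sec_mul UV.1 UV.2 (f UV.1) (g UV.2).

Definition formal_star (f : formal) : formal :=
  fun U => sec_star (f (binv U)).

Definition formal_sums (S : set (set G)) (A : set G -> set (section B)) :
    set formal :=
  [set f | [/\ finite_set [set U | f U != 0],
               forall U, S U -> A U (f U) &
               forall U, ~ S U -> f U = 0]].

Definition CcA (S : set (set G)) := formal_sums S (@C0sec R G B).
Definition CcA0 (S : set (set G)) := formal_sums S (@Ccsec R G B).

(* The linear span of these differences is already an ideal of [CcA S].  As
   sections are extended by zero, j_(V,U)(s) is s. *)
Definition idealA (S : set (set G)) : set formal :=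
  lspan [set h : formal | exists U V s,
    [/\ S U, S V, U `<=` V, C0sec U s &
        h = delta U s - delta V s]].

Definition CcA_mod_I (S : set (set G)) : starSubquotient R :=
  @StarSubquotient R formal formal_mul formal_star
    (CcA S) (idealA S).

Definition CcB : set (section B) :=
  [set s | exists (n : nat) (U : 'I_n -> set G) (t : 'I_n -> section B),
     (forall i, [/\ open (U i), hausdorff_space (set_type (U i)) &
                    Ccsec (U i) (t i)]) /\
     s = \sum_(i < n) t i].

Definition CcB_alg : starSubquotient R :=
  @StarSubquotient R (section B) (conv_on setT) sec_star CcB [set 0].

Definition Psi (f : formal) : section B := \sum_(U \in setT) f U.

End Algebras.
Arguments CcA {R G} B S.
Arguments CcA0 {R G} B S.
Arguments idealA {R G} B S.
Arguments CcB {R G} B.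

(* Main.v *)
From mathcomp Require Import all_boot all_order all_algebra.
From mathcomp.real_closed Require Import complex.
From mathcomp Require Import all_classical all_reals.
From mathcomp Require Import topology normedtype.
From mathcomp Require Import ring lra.
Require Import Defs.

Set Implicit Arguments.
Unset Strict Implicit.
Unset Printing Implicit Defensive.

Import Order.TTheory GRing.Theory Num.Theory.
Import numFieldNormedType.Exports.

Local Open Scope classical_set_scope.
Local Open Scope ring_scope.

(** Both C*-algebras are enveloping algebras, so it suffices to produce a
    *-homomorphism in each direction and to see that they are inverse to each
    other on generators.  A *-homomorphism on formal sums is the same as a
    family of linear maps [T U] on the sections over the members [U] of [S]
    that is multiplicative, compatible with the involution, and compatible with
    the inclusions [U <= V]: a representation of the Fell bundle over [S]
    ([bundle_rep], [star_hom_rep], [formal_rep_hom]).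

    Such representations are automatically bounded by twice the supremum norm
    ([rep_bound]).  By the C*-identity this is a question about a self-adjoint
    section [h] over units.  If [h] has norm at most 1/2, then
    [k = 1 - sqrt (1 - h^2)], obtained fibrewise as the limit of an iteration,
    is again a section of the same kind ([section_root]).  The relation
    [2 k - k^2 = h^2] makes [1 - k + i h] a unitary, which forces the image of
    [h] to have norm at most 1 in every C*-algebra ([cs_unitary_norm]).
    Boundedness lets a representation on compactly supported sections extend
    to sections vanishing at infinity ([rep_extend]).  Applied to a
    *-homomorphism on [CcB] this gives the map from C*(A) to C*(B).

    The converse direction has to send a sum of sections [xi_U] to the sum of
    the [T U xi_U], and the point is that this depends on the sum only.  This
    is [rep_sum_bound]: the norm of the sum of the [T U xi_U] is at most a
    constant, depending on the family of the [U], times the supremum norm of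
    the sum of the [xi_U].  By induction on the number of summands, where the
    first one is large some other one does not vanish, so that wideness of [S]
    provides a member of [S] contained in both slices.  Using bump functions
    ([peel]), the first summand is redistributed over the others up to a small
    section, whose image is small by [rep_bound].  Every element of [CcB] is
    such a sum, again by [peel] ([rep_val_Cc]). *)

(** * Real-valued norms *)

Lemma conjCR (R : realType) (x : R) : Num.conj (x%:C%C) = x%:C%C.
Proof. exact: conjc_real. Qed.

Section RealNorm.
Variables (R : realType) (E : normedModType R[i]).
Implicit Types (u v w : E) (e : R).

Lemma rnormE v : `|v| = (rnorm v)%:C%C.
Proof. by rewrite /rnorm RRe_real // normr_real. Qed.

Lemma rnorm_ge0 v : 0 <= rnorm v.
Proof. by rewrite -lecR -rnormE; exact: normr_ge0. Qed.

Lemma rnorm0 : rnorm (0 : E) = 0.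
Proof. by rewrite /rnorm normr0. Qed.

Lemma rnorm0_eq0 v : rnorm v <= 0 -> v = 0.
Proof.
by move=> v0; apply/eqP; rewrite -normr_le0 rnormE lecR.
Qed.

Lemma rnormD v w : rnorm (v + w) <= rnorm v + rnorm w.
Proof. by rewrite -lecR rmorphD /= -!rnormE ler_normD. Qed.

Lemma rnormN v : rnorm (- v) = rnorm v.
Proof. by rewrite /rnorm normrN. Qed.

Lemma rnormB v w : rnorm (v - w) <= rnorm v + rnorm w.
Proof. by rewrite -(rnormN w) rnormD. Qed.

Lemma rnorm_distC v w : rnorm (v - w) = rnorm (w - v).
Proof. by rewrite -rnormN opprB. Qed.

Lemma rnorm_dist u v w : rnorm (u - w) <= rnorm (u - v) + rnorm (v - w).
Proof. by rewrite -[u - w](subrKA v) rnormD. Qed.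

Lemma rnormZ (k : R[i]) v : rnorm (k *: v) = complex.Re `|k| * rnorm v.
Proof.
by rewrite {1}/rnorm normrZ rnormE normc_def /= mul0r subr0.
Qed.

Lemma rnormZR (k : R) v : rnorm (k%:C%C *: v) = `|k| * rnorm v.
Proof.
by rewrite rnormZ normc_def /= expr0n /= addr0 sqrtr_sqr.
Qed.

Lemma rnorm_small_eq0 v (C : R) :
  (forall e, 0 < e -> rnorm v <= C * e) -> v = 0.
Proof.
move=> small; apply: rnorm0_eq0; rewrite leNgt; apply/negP => v0.
have C0 : 0 < C by have := small _ ltr01; rewrite mulr1; exact: lt_le_trans.
have := small (rnorm v / (2 * C)) (divr_gt0 v0 (mulr_gt0 (ltr0Sn R 1) C0)).
have -> : C * (rnorm v / (2 * C)) = rnorm v / 2 by field; lra.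
lra.
Qed.

End RealNorm.

(** Completeness with an explicit modulus [b], the form in which limits are taken
    below. *)
Lemma rnorm_complete (R : realType) (E : completeNormedModType R[i])
    (u : nat -> E) (b : nat -> R) :
  (forall e, 0 < e -> exists N, b N <= e) ->
  (forall n m, (n <= m)%N -> rnorm (u m - u n) <= b n) ->
  exists l, forall n, rnorm (l - u n) <= b n.
Proof.
move=> b0 uC.
have cu : cauchy (u @ \oo).
  apply/cauchyP => e e0.
  have eE : e = (complex.Re e)%:C%C by rewrite RRe_real // gtr0_real.
  have e0' : 0 < complex.Re e by rewrite -ltcR -eE.
  have [N bN] := b0 (complex.Re e / 2) (divr_gt0 e0' (ltr0Sn R 1)).
  exists (u N).
  exists N => // m /= Nm; rewrite -ball_normE /ball_ /=.
  rewrite rnormE eE ltcR rnorm_distC; apply: (le_lt_trans (uC _ _ Nm)).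
  lra.
have uF : ProperFilter (u @ \oo) by exact: fmap_proper_filter.
have ul : u @ \oo --> lim (u @ \oo) by exact: cauchy_cvg.
set l := lim _ in ul; exists l => n; apply/ler_addgt0Pr => e e0.
have e0' : 0 < e%:C%C :> R[i] by rewrite ltcR.
have [N _ NP] := ul _ (nbhsx_ballx l _ e0').
have := NP (maxn N n) (leq_maxl _ _); rewrite /= -ball_normE /ball_ /=.
rewrite rnormE ltcR => lu; apply: (le_trans (rnorm_dist l (u (maxn N n)) (u n))).
by rewrite addrC lerD ?uC ?leq_maxr // ltW.
Qed.

(** * C*-algebras *)

Section CstarAlgebra.
Variables (R : realType) (D : cstarAlgebra R).
Implicit Types (a b c : D) (k : R[i]).
Local Notation "a ** b" := (cs_mul D a b) (at level 40, left associativity).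
Local Notation "a ^^*" := (cs_star D a) (at level 2, format "a ^^*").

Lemma cs_mulDl a a' b : (a + a') ** b = a ** b + a' ** b.
Proof. by have := cs_linearl 1 a a' b; rewrite !scale1r. Qed.

Lemma cs_mulDr a b b' : a ** (b + b') = a ** b + a ** b'.
Proof. by have := cs_linearr 1 a b b'; rewrite !scale1r. Qed.

Lemma cs_mul0l b : 0 ** b = 0.
Proof. by apply/(addIr (0 ** b)); rewrite -cs_mulDl !add0r. Qed.

Lemma cs_mul0r a : a ** 0 = 0.
Proof. by apply/(addIr (a ** 0)); rewrite -cs_mulDr !add0r. Qed.

Lemma cs_mulZl k a b : (k *: a) ** b = k *: (a ** b).
Proof. by have := cs_linearl k a 0 b; rewrite cs_mul0l !addr0. Qed.

Lemma cs_mulZr k a b : a ** (k *: b) = k *: (a ** b).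
Proof. by have := cs_linearr k a b 0; rewrite cs_mul0r !addr0. Qed.

Lemma cs_mulNl a b : (- a) ** b = - (a ** b).
Proof. by rewrite -scaleN1r cs_mulZl scaleN1r. Qed.

Lemma cs_mulNr a b : a ** (- b) = - (a ** b).
Proof. by rewrite -scaleN1r cs_mulZr scaleN1r. Qed.

Lemma cs_mulBl a a' b : (a - a') ** b = a ** b - a' ** b.
Proof. by rewrite cs_mulDl cs_mulNl. Qed.

Lemma cs_mulBr a b b' : a ** (b - b') = a ** b - a ** b'.
Proof. by rewrite cs_mulDr cs_mulNr. Qed.

Lemma cs_starD a b : (a + b)^^* = a^^* + b^^*.
Proof. by have := cs_star_conj_linear 1 a b; rewrite !scale1r rmorph1 scale1r. Qed.

Lemma cs_star0 : (0 : D)^^* = 0.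
Proof. by apply/(addIr 0^^*); rewrite -cs_starD !add0r. Qed.

Lemma cs_starZ k a : (k *: a)^^* = (Num.conj k) *: a^^*.
Proof. by have := cs_star_conj_linear k a 0; rewrite cs_star0 !addr0. Qed.

Lemma cs_starN a : (- a)^^* = - a^^*.
Proof. by rewrite -scaleN1r cs_starZ rmorphN1 scaleN1r. Qed.

Lemma cs_starB a b : (a - b)^^* = a^^* - b^^*.
Proof. by rewrite cs_starD cs_starN. Qed.

Lemma cs_star_norm a : rnorm a^^* = rnorm a.
Proof.
suff le b : rnorm b <= rnorm b^^*.
  by apply/eqP; rewrite eq_le le andbT -{2}(cs_starK a) le.
have := cs_mul_norm b^^* b; rewrite cs_cstar expr2.
have [b0|b0 /(ler_wpM2r _)] := leP (rnorm b) 0; first by rewrite (le_trans b0) ?rnorm_ge0.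
by move=> H; rewrite -(ler_pM2r b0); have := cs_mul_norm b^^* b; rewrite cs_cstar expr2.
Qed.

(** With [u = 1 - k + i y] the hypotheses say that [u] is a unitary of the
    unitization: left multiplication by [u] and by [u^*] is isometric, and
    [y] is the mean of [- i u] and [i u^*]. *)
Lemma cs_unitary_norm (y k : D) : y^^* = y -> k^^* = k -> y ** k = k ** y ->
  k + k - k ** k = y ** y -> rnorm y <= 1.
Proof.
move=> ys ks yk ykk.
have iso (j : R[i]) a : Num.conj j = - j -> j * j = -1 ->
    rnorm (a - k ** a + j *: (y ** a)) = rnorm a.
  move=> js jj; set p := a - k ** a; set q := y ** a.
  have pE : p^^* = a^^* - a^^* ** k by rewrite cs_starB cs_starM ks.
  have qE : q^^* = a^^* ** y by rewrite cs_starM ys.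
  have pq : p^^* ** q = q^^* ** p.
    by rewrite pE qE cs_mulBl cs_mulBr -!cs_mulA !(cs_mulA k) !(cs_mulA y) yk.
  have pp : p^^* ** p + q^^* ** q = a^^* ** a.
    rewrite pE qE cs_mulBl !cs_mulBr -!cs_mulA !(cs_mulA k) !(cs_mulA y).
    rewrite -ykk cs_mulBl !cs_mulBr cs_mulDl cs_mulDr.
    set Bk := a^^* ** (k ** a). set K2 := a^^* ** (k ** k ** a).
    by rewrite -(addrA Bk Bk) (addrC Bk (Bk - K2)) addrA subrK subrK.
  clearbody p q; apply/eqP; rewrite -(@eqrXn2 _ 2) ?rnorm_ge0 //; apply/eqP.
  rewrite -!cs_cstar; congr rnorm.
  rewrite cs_starD cs_starZ js !(cs_mulDl, cs_mulDr, cs_mulZl, cs_mulZr).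
  rewrite !scalerA mulrN jj opprK scale1r pq scaleNr.
  by rewrite -addrA addNKr pp.
have y2 : rnorm (y ** y) <= rnorm y.
  have ci : Num.conj ('i%C : R[i]) = - 'i%C by apply/eqP; rewrite eq_complex /= oppr0 !eqxx.
  have ii : ('i%C : R[i]) * 'i%C = -1 by rewrite -expr2 sqr_i.
  have := rnormB (y - k ** y + 'i%C *: (y ** y)) (y - k ** y + - 'i%C *: (y ** y)).
  have cni : Num.conj (- 'i%C : R[i]) = - - 'i%C by rewrite -{2}ci; exact: rmorphN.
  rewrite !iso ?mulrNN //.
  rewrite opprD addrACA subrr add0r scaleNr opprK -scalerDl rnormZ.
  have -> : complex.Re `|'i%C + 'i%C : R[i]| = 2.
    by rewrite normc_def /= addr0 expr0n add0r sqrtr_sqr ger0_norm ?addr_ge0.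
  lra.
move: y2; have := cs_cstar y; rewrite ys => ->; rewrite expr2 => y2.
have [y0|y0] := leP (rnorm y) 0; first by rewrite (le_trans y0).
by rewrite -(ler_pM2r y0) mul1r.
Qed.

(** The iteration for [1 - sqrt (1 - h^2)], the smaller root [k] of
    [2 k - k^2 = h^2]. *)
Fixpoint root_iter (h : D) n : D :=
  if n is n'.+1 then (2^-1)%:C%C *: (h ** h + root_iter h n' ** root_iter h n')
  else 0.

Section RootIteration.
Variable h : D.
Hypotheses (hs : h^^* = h) (h_le : rnorm h <= 2^-1).
Let rt := root_iter h.

Lemma root_iter_norm n : rnorm (rt n) <= rnorm h.
Proof.
elim: n => [|n IH] /=; first by rewrite rnorm0 rnorm_ge0.
rewrite rnormZR ger0_norm ?invr_ge0//.
apply: (le_trans (ler_wpM2l _ (rnormD _ _))); first by rewrite invr_ge0.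
apply: (@le_trans _ _ (2^-1 * (rnorm h * rnorm h + rnorm (rt n) * rnorm (rt n)))).
  by rewrite ler_wpM2l ?invr_ge0 // lerD ?cs_mul_norm.
have := rnorm_ge0 h; have := rnorm_ge0 (rt n); have := h_le; have := IH.
move: (rnorm h) (rnorm (rt n)) => a b; nra.
Qed.

Lemma root_iter_star n : (rt n)^^* = rt n.
Proof.
elim: n => [|n IH] /=; first exact: cs_star0.
by rewrite cs_starZ conjCR cs_starD !cs_starM hs IH.
Qed.

Lemma root_iter_comm n : rt n ** h = h ** rt n.
Proof.
elim: n => [|n IH] /=; first by rewrite cs_mul0l cs_mul0r.
rewrite cs_mulZl cs_mulZr cs_mulDl cs_mulDr cs_mulA; congr (_ *: (_ + _)).
by rewrite -cs_mulA IH cs_mulA IH cs_mulA.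
Qed.

Lemma root_iter_step n : rnorm (rt n.+1 - rt n) <= (2^-1) ^+ n.
Proof.
elim: n => [|n IH].
  rewrite expr0 subr0; apply: (le_trans (root_iter_norm 1)).
  by apply: (le_trans h_le); lra.
rewrite [rt n.+2]/= [rt n.+1 in X in _ - X]/= -scalerBr opprD addrACA subrr add0r.
rewrite -/(rt n) -/(rt n.+1).
have -> : rt n.+1 ** rt n.+1 - rt n ** rt n =
    rt n.+1 ** (rt n.+1 - rt n) + (rt n.+1 - rt n) ** rt n.
  by rewrite cs_mulBr cs_mulBl addrA subrK.
rewrite rnormZR ger0_norm ?invr_ge0// exprS ler_wpM2l ?invr_ge0//.
apply: (le_trans (rnormD _ _)).
apply: (le_trans (lerD (cs_mul_norm _ _) (cs_mul_norm _ _))).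
rewrite mulrC -mulrDr; apply: le_trans IH.
rewrite ler_piMr ?rnorm_ge0 //.
have := root_iter_norm n; have := root_iter_norm n.+1; move: h_le; lra.
Qed.

Lemma root_iter_cauchy n m : (n <= m)%N ->
  rnorm (rt m - rt n) <= 2 * (2^-1) ^+ n.
Proof.
move=> nm; suff : rnorm (rt m - rt n) <= 2 * (2^-1) ^+ n - 2 * (2^-1) ^+ m.
  have : 0 < (2^-1 : R) ^+ m by rewrite exprn_gt0 ?invr_gt0.
  by lra.
rewrite -(subnK nm); elim: (m - n)%N => [|d IH]; first by rewrite !subrr rnorm0.
rewrite addSn; apply: (le_trans (rnorm_dist _ (rt (d + n)) _)).
apply: (le_trans (lerD (root_iter_step _) IH)).
by rewrite exprS; lra.
Qed.

End RootIteration.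

Lemma geometric_small (e : R) : 0 < e -> exists N, 2 * (2^-1) ^+ N <= e.
Proof.
move=> e0; exists (Num.bound (2 / e)).
have := upper_nthrootP (leqnn (Num.bound (2 / e))).
rewrite exprVn ltr_pdivrMr // => /ltW; rewrite -ler_pdivrMl ?exprn_gt0 //.
by rewrite mulrC.
Qed.

Lemma cs_root (h : D) : h^^* = h -> rnorm h <= 2^-1 ->
  exists k : D, [/\ forall n, rnorm (k - root_iter h n) <= 2 * (2^-1) ^+ n,
    k^^* = k, k ** h = h ** k, rnorm k <= rnorm h & k + k - k ** k = h ** h].
Proof.
move=> hs hle; set rt := root_iter h.
have [k kP] := rnorm_complete geometric_small (root_iter_cauchy hle).
have approx (z : D) (C : R) :
    (forall n, rnorm z <= C * (2 * (2^-1) ^+ n)) -> z = 0.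
  have [C0|C0] := leP C 0.
    move=> /(_ 0%N) zC; apply: rnorm0_eq0; apply: (le_trans zC).
    by rewrite mulr_le0_ge0 // mulr_ge0.
  move=> small; apply: (@rnorm_small_eq0 _ _ _ C) => e /geometric_small[N Ne].
  by apply: (le_trans (small N)); rewrite ler_pM2l.
have k_le : rnorm k <= rnorm h.
  apply/ler_addgt0Pr => e /geometric_small[N Ne].
  rewrite -(subrK (rt N) k) (le_trans (rnormD _ _)) // addrC lerD //.
    exact: root_iter_norm.
  exact: le_trans (kP N) Ne.
have kh n : rnorm ((k - rt n) ** h) <= 2 * (2^-1) ^+ n * rnorm h.
  by apply: (le_trans (cs_mul_norm _ _)); rewrite ler_wpM2r ?rnorm_ge0.
exists k; split => //.
- apply/eqP; rewrite -subr_eq0; apply/eqP; apply: (approx _ 2) => n.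
  have -> : k^^* - k = (k - rt n)^^* - (k - rt n).
    by rewrite cs_starB root_iter_star // opprB addrA subrK.
  apply: (le_trans (rnormB _ _)); rewrite cs_star_norm; have := kP n; rewrite -/rt; lra.
- apply/eqP; rewrite -subr_eq0; apply/eqP; apply: (approx _ (2 * rnorm h)) => n.
  have -> : k ** h - h ** k = (k - rt n) ** h - h ** (k - rt n).
    by rewrite cs_mulBl cs_mulBr root_iter_comm // opprB addrA subrK.
  apply: (le_trans (rnormB _ _)).
  apply: (le_trans (lerD (cs_mul_norm _ _) (cs_mul_norm _ _))).
  have := kP n; have := rnorm_ge0 h; rewrite -/rt; move: (rnorm _) (rnorm _) => a b; nra.
- apply/eqP; rewrite -subr_eq0; apply/eqP; apply: (approx _ 4) => n.
  have -> : k + k - k ** k - h ** h =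
      ((k - rt n.+1) + (k - rt n.+1)) - (k ** (k - rt n) + (k - rt n) ** rt n).
    have E : rt n.+1 + rt n.+1 = h ** h + rt n ** rt n.
      by rewrite /= -scalerDl -rmorphD /= (_ : 2^-1 + 2^-1 = 1) ?scale1r //; lra.
    have -> : (k - rt n.+1) + (k - rt n.+1) = k + k - (h ** h + rt n ** rt n).
      by rewrite addrACA -opprD E.
    have -> : k ** (k - rt n) + (k - rt n) ** rt n = k ** k - rt n ** rt n.
      by rewrite cs_mulBr cs_mulBl addrA subrK.
    by rewrite opprB addrA opprD [in RHS]addrA subrK addrAC.
  apply: (le_trans (rnormB _ _)).
  apply: (le_trans (lerD (rnormD _ _) (rnormD _ _))).
  have x_le : rnorm (k ** (k - rt n)) <= 2^-1 * rnorm (k - rt n).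
    apply: (le_trans (cs_mul_norm _ _)); rewrite ler_wpM2r ?rnorm_ge0 //.
    exact: le_trans k_le hle.
  have y_le : rnorm ((k - rt n) ** rt n) <= rnorm (k - rt n) * 2^-1.
    apply: (le_trans (cs_mul_norm _ _)); rewrite ler_wpM2l ?rnorm_ge0 //.
    exact: le_trans (root_iter_norm hle n) hle.
  have := kP n; have := kP n.+1; rewrite -/rt exprS.
  have : 0 <= (2^-1 : R) ^+ n by rewrite exprn_ge0 ?invr_ge0.
  lra.
Qed.

End CstarAlgebra.

(** * Point-set topology *)

Section Topology.
Variable X : topologicalType.
Implicit Types (U V K : set X).

Lemma within_open_cts (Y : topologicalType) (f : X -> Y) U x :
  open U -> {within U, continuous f} -> U x -> f @ x --> f x.
Proof.
by move=> oU; rewrite continuous_open_subspace // => + Ux; apply; exact/mem_set.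
Qed.

Lemma within_cts_at (Y : topologicalType) (f : X -> Y) U x (N : set Y) :
  {within U, continuous f} -> U x -> nbhs (f x) N ->
  \forall y \near x, U y -> N (f y).
Proof.
move=> fc Ux Nf; have := fc x _ Nf.
by rewrite nbhs_simpl /= /nbhs /= -nbhs_subspace_in //; exact/mem_set.
Qed.

Lemma open_cts_within (Y : topologicalType) (f : X -> Y) U :
  (forall x, U x -> f @ x --> f x) -> {within U, continuous f}.
Proof. by move=> fc; apply: continuous_in_subspaceT => x /set_mem; exact: fc. Qed.

(** Compactness as an induction principle: take as filter on the sets [O] with
    [Q O] the one generated by the sets of those that contain a given one. *)
Lemma compact_ind (Q : set X -> Prop) K : compact K -> Q set0 ->
  (forall A B, Q A -> Q B -> Q (A `|` B)) ->
  (forall x, K x -> exists2 O, nbhs x O & Q O) ->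
  exists2 O, K `<=` O & Q O.
Proof.
move=> /compact_near_coveringP cK Q0 QU Qloc.
pose F : set_system (set X) :=
  [set A | exists2 O, Q O & forall O', Q O' -> O `<=` O' -> A O'].
have FF : Filter F.
  split.
  - by exists set0.
  - move=> A A' [O QO OA] [O' QO' OA']; exists (O `|` O'); first exact: QU.
    move=> O'' QO'' sub; split; [apply: OA|apply: OA'] => // x Ox; apply: sub.
      by left.
    by right.
  - by move=> A A' AA' [O QO OA]; exists O => // O' QO' OO'; exact/AA'/OA.
have /(_ _)[x /Qloc[O Ox QO]|O QO OP] := cK _ F (fun O x => O x) FF.
  exists (O, [set O' | O `<=` O']) => /=; last by case=> y O' /= [Oy /(_ _ Oy)].
  by split => //; exists O.
by exists O => //; apply: OP.
Qed.

(** The Hausdorff property of a subspace, in terms of neighbourhoods in the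
    ambient space. *)
Definition separated_on U := forall x y, U x -> U y -> x <> y ->
  exists A B, [/\ nbhs x A, nbhs y B & A `&` B = set0].

Lemma hausdorff_separated U : open U ->
  hausdorff_space (set_type U) -> separated_on U.
Proof.
move=> oU; rewrite open_hausdorff => hU x y Ux Uy xy.
pose x' : set_type U := exist _ x (mem_set Ux).
pose y' : set_type U := exist _ y (mem_set Uy).
have [|[A B] /= [/set_mem Ax /set_mem By]] := hU x' y'.
  by apply/eqP => /(congr1 val).
case=> -[A' oA' A'E] [B' oB' B'E] /eqP AB; exists (A' `&` U), (B' `&` U); split.
- by apply: open_nbhs_nbhs; split; [exact: openI|split => //; rewrite -A'E in Ax].
- by apply: open_nbhs_nbhs; split; [exact: openI|split => //; rewrite -B'E in By].
- rewrite -subset0 => z [[A'z Uz] [B'z _]].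
  have : (A `&` B) (exist _ z (mem_set Uz)) by rewrite -A'E -B'E.
  by rewrite AB.
Qed.

Lemma separated_hausdorff U : separated_on U -> hausdorff_space (set_type U).
Proof.
move=> sU [x Ux] [y Uy] xy; apply: val_inj => /=; apply: contrapT => nxy.
have [A [B [Ax By AB]]] := sU x y (set_mem Ux) (set_mem Uy) nxy.
have nA := @initial_continuous _ _ val (exist _ x Ux : set_type U) _ Ax.
have nB := @initial_continuous _ _ val (exist _ y Uy : set_type U) _ By.
have [z [/= Az Bz]] := xy _ _ nA nB.
by have : (A `&` B) (val z) by []; rewrite AB.
Qed.

(** Compact subsets of a Hausdorff subspace are relatively closed, although they
    need not be closed in the whole space. *)
Lemma separated_compactC V K y : separated_on V -> K `<=` V -> compact K ->
  V y -> ~ K y -> nbhs y (~` K).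
Proof.
move=> sV KV cK Vy nKy.
pose Q (O : set X) := nbhs y (~` O).
have [|A B QA QB|x Kx|O KO QO] := @compact_ind Q K cK.
- by rewrite /Q setC0; exact: filterT.
- by rewrite /Q setCU; exact: filterI.
- have [|A [B [Ax By AB]]] := sV x y (KV _ Kx) Vy; first by move=> E; rewrite E in Kx.
  exists A => //; apply: filterS By => z Bz Az.
  by have : (A `&` B) z by []; rewrite AB.
by move: QO; rewrite /Q; apply: filterS => z nO /KO.
Qed.

End Topology.

(** * Étale groupoids *)

Section EtaleGroupoid.
Variable G : etaleGroupoid.
Implicit Types (x y z : G) (U V W O : set G).

Lemma src_cts : continuous (@src G).
Proof.
by move=> x; have [U [oU Ux [sU _] _]] := src_local_homeo x; exact: within_open_cts sU Ux.
Qed.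

Lemma rng_cts : continuous (@rng G).
Proof.
by move=> x; have [U [oU Ux [sU _] _]] := rng_local_homeo x; exact: within_open_cts sU Ux.
Qed.

Lemma unit_rng x : src x = x -> rng x = x.
Proof. by move=> <-; rewrite rng_src. Qed.

(** Near a unit [x], the arrows [y] and [src y] both lie in an open set on which
    [src] is injective. *)
Lemma units_open : open (units G).
Proof.
rewrite openE => x; rewrite /units /= /interior => xu.
have [U [oU Ux [_ [g _ gK]] _]] := src_local_homeo x.
have nU : nbhs x U by exact: open_nbhs_nbhs.
have nsU : nbhs x (@src G @^-1` U) by apply: src_cts; rewrite xu.
by apply: filterS2 nU nsU => y Uy Usy; rewrite /= -(gK _ Usy) src_src gK.
Qed.

(** The image of a neighbourhood is relatively open among the units, which form
    an open set. *)
Lemma local_homeo_open (f : G -> G) O : local_homeo_to_units f ->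
  open O -> open (f @` O).
Proof.
move=> lf oO; rewrite openE => _ [x Ox <-].
have [U [oU Ux [fc [g gc gK]] [V oV fU]]] := lf x.
have ofU : open (f @` U) by rewrite fU; apply: openI => //; exact: units_open.
have fUx : (f @` U) (f x) by exists x.
have gx := within_open_cts ofU gc fUx; rewrite gK // in gx.
have nO : nbhs x O by exact: open_nbhs_nbhs.
have fN := open_nbhs_nbhs (conj ofU fUx).
have gN : nbhs (f x) (g @^-1` O) := gx _ nO.
apply: filterS2 fN gN => _ [z Uz <-] /=; rewrite gK // => Oz.
by exists z.
Qed.

Lemma src_open O : open O -> open (@src G @` O).
Proof. exact/local_homeo_open/src_local_homeo. Qed.

Lemma rng_open O : open O -> open (@rng G @` O).
Proof. exact/local_homeo_open/rng_local_homeo. Qed.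

Lemma units_separated : separated_on (units G).
Proof. exact: hausdorff_separated units_open (@units_hausdorff G). Qed.

Lemma ginvK : involutive (@ginv G).
Proof.
move=> x; rewrite -[LHS]gmul_src src_inv rng_inv -gmulVl gmulA.
- by rewrite gmulVl src_inv gmul_rng.
- by rewrite src_inv rng_inv.
- by rewrite src_inv.
Qed.

Lemma gmul_mulVl x y z : src x = rng y -> gmul x y = z -> y = gmul (ginv x) z.
Proof. by move=> xy <-; rewrite gmulA ?src_inv // gmulVl xy gmul_rng. Qed.

Lemma unit_inv x : src x = x -> ginv x = x.
Proof.
by move=> xu; rewrite -{2}(unit_rng xu) -gmulV {2}(esym xu) -rng_inv gmul_rng.
Qed.

Lemma gmul_unit x : src x = x -> gmul x x = x.
Proof. by move=> xu; rewrite -{2}xu gmul_src. Qed.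

(** The maps [src] and [rng] are continuous and open, so injectivity on an open
    set is all that a bissection requires. *)
Definition slice U := [/\ open U,
  forall x y, U x -> U y -> src x = src y -> x = y &
  forall x y, U x -> U y -> rng x = rng y -> x = y].

Lemma bissection_slice U : bissection U -> slice U.
Proof.
move=> [oU [_ [g _ gK]] [_ [h _ hK]]]; split => // x y Ux Uy xy.
  by rewrite -(gK x) // xy gK.
by rewrite -(hK x) // xy hK.
Qed.

(** Distinct arrows of a slice have distinct sources, which are separated in the
    unit space. *)
Lemma slice_separated U : slice U -> separated_on U.
Proof.
move=> [oU sI _] x y Ux Uy xy.
have [||E|A [B [nA nB AB]]] := @units_separated (src x) (src y).
- exact: src_src.
- exact: src_src.
- exact/xy/sI.
exists (@src G @^-1` A), (@src G @^-1` B); split; [exact: src_cts|exact: src_cts|].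
by rewrite -preimage_setI AB preimage_set0.
Qed.

(** Intersect the neighbourhood with open sets on which [src] and [rng] are
    injective. *)
Lemma slice_basis x O : nbhs x O -> exists W, [/\ slice W, W x & W `<=` O].
Proof.
move=> nO.
have [U [oU Ux [_ [g _ gK]] _]] := src_local_homeo x.
have [V [oV Vx [_ [h _ hK]] _]] := rng_local_homeo x.
exists (U `&` V `&` O°); split; [split| |].
- by apply: openI; [exact: openI|exact: open_interior].
- by move=> y z [[Uy _] _] [[Uz _] _] yz; rewrite -(gK y) // yz gK.
- by move=> y z [[_ Vy] _] [[_ Vz] _] yz; rewrite -(hK y) // yz hK.
- by split.
- by move=> y [_]; exact: interior_subset.
Qed.

(** The inverse of [f] restricted to [U]; used for [src] and [rng] on slices. *)
Definition lift (f : G -> G) U y := xget y [set x | U x /\ f x = y].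

Lemma liftE (f : G -> G) U x : (forall y, U y -> f y = f x -> y = x) ->
  U x -> lift f U (f x) = x.
Proof.
move=> inj Ux; rewrite /lift.
by case: xgetP => [y _ [Uy /inj]|/(_ x)[]]; [exact|split].
Qed.

Lemma lift_cts (f : G -> G) U x : local_homeo_to_units f -> open U ->
  (forall y z, U y -> U z -> f y = f z -> y = z) -> U x -> lift f U @ f x --> x.
Proof.
move=> lf oU inj Ux N; rewrite nbhsE => -[O [oO Ox] ON].
rewrite nbhs_filterE /=.
have oUO : open (O `&` U) by exact: openI.
have fUx : (f @` (O `&` U)) (f x) by exists x.
apply: filterS (open_nbhs_nbhs (conj (local_homeo_open lf oUO) fUx)).
by move=> _ [z [Oz Uz] <-] /=; rewrite liftE //; [exact: ON|move=> y Uy; exact: inj].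
Qed.

End EtaleGroupoid.

(** * Continuity of sections of a Banach bundle *)

Section BanachBundle.
Variables (R : realType) (X : topologicalType) (B : banachBundle R X).
Local Notation T := (tot B).
Implicit Types (x y : X) (a b : T) (s t : section B) (e : R).

Lemma inc_eq x y (v : fib B x) (w : fib B y) :
  inc B v = inc B w -> existT (fun z => fib B z : Type) x v = existT _ y w.
Proof.
move=> E; have xy : x = y by rewrite -(proj_inc v) E proj_inc.
by case: y / xy w E => w E; rewrite (Defs.inc_inj E).
Qed.

Lemma inc_fiber_at x b : proj B b = x -> inc B (fiber_at x b) = b.
Proof.
move=> bx; rewrite /fiber_at; case: pselect => // e.
by case: x / e {bx} => /=; rewrite vecK.
Qed.

Lemma fiber_at_inc x (v : fib B x) : fiber_at x (inc B v) = v.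
Proof. by apply: (@Defs.inc_inj _ _ B x); rewrite inc_fiber_at // proj_inc. Qed.

Lemma fiber_at_out x b : proj B b <> x -> fiber_at x b = 0.
Proof. by move=> bx; rewrite /fiber_at; case: pselect. Qed.

(** The fibre of [vec (inc v)] is only provably that of [v]; this replaces one
    vector by the other in any statement. *)
Lemma vec_inc_ind x (v : fib B x) (Q : forall y, fib B y -> Prop) :
  Q x v -> Q (proj B (inc B v)) (vec B (inc B v)).
Proof.
move=> Qv; pose Q' (p : {y : X & (fib B y : Type)}) := Q (projT1 p) (projT2 p).
rewrite -[Q _ _]/(Q' (existT (fun y : X => fib B y : Type) _ (vec B (inc B v)))).
by rewrite (inc_eq (vecK (inc B v))).
Qed.

(** The vector operations as functions on the total space, where convergence
    takes place. *)
Definition tadd a b : T := inc B (vec B a + fiber_at (proj B a) b).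
Definition tscale (k : R[i]) a : T := inc B (k *: vec B a).
Definition tnorm a : R := rnorm (vec B a).

Lemma tadd_inc x (v w : fib B x) : tadd (inc B v) (inc B w) = inc B (v + w).
Proof.
by apply: (vec_inc_ind (Q := fun y u =>
  inc B (u + fiber_at y (inc B w)) = inc B (v + w))); rewrite fiber_at_inc.
Qed.

Lemma tscale_inc x k (v : fib B x) : tscale k (inc B v) = inc B (k *: v).
Proof. exact: (vec_inc_ind (Q := fun y u => inc B (k *: u) = inc B (k *: v))). Qed.

Lemma tnorm_inc x (v : fib B x) : tnorm (inc B v) = rnorm v.
Proof. exact: (vec_inc_ind (Q := fun y u => rnorm u = rnorm v)). Qed.

Section Limits.
Variables (Z : Type) (F : set_system Z) (FF : Filter F).
Implicit Types f g : Z -> T.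

Lemma tadd_cvg f g a b : (forall z, proj B (f z) = proj B (g z)) ->
  proj B a = proj B b -> f @ F --> a -> g @ F --> b ->
  (fun z => tadd (f z) (g z)) @ F --> tadd a b.
Proof.
move=> fg ab fa gb N nN.
have H := within_cts_at (x := (a, b)) (@add_continuous _ _ B) ab nN.
have fgH : F [set z | proj B (f z) = proj B (g z) -> N (tadd (f z) (g z))].
  exact: (cvg_pair fa gb H).
change (F [set z | N (tadd (f z) (g z))]).
by apply: filterS fgH => z /=; apply.
Qed.

Lemma tscale_cvg k f a : f @ F --> a -> (fun z => tscale k (f z)) @ F --> tscale k a.
Proof. by move=> fa; apply: cvg_comp fa (@scale_continuous _ _ B k a). Qed.

Lemma tnorm_usc f a e : f @ F --> a -> tnorm a < e -> \forall z \near F, tnorm (f z) < e.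
Proof.
by move=> fa ae; apply: fa (open_nbhs_nbhs (conj (norm_usc B e) _)).
Qed.

End Limits.

Lemma tnull_cvg (Z : Type) (F : set_system Z) (FF : ProperFilter F) (f : Z -> T) x :
  proj B \o f @ F --> x ->
  (forall e, 0 < e -> \forall z \near F, tnorm (f z) <= e) ->
  f @ F --> inc B (0 : fib B x).
Proof.
move=> fx f0; apply: null_cvg => //.
apply/cvgrPdist_le => e e0; have := f0 e e0.
by apply: filterS => z /=; rewrite sub0r normrN ger0_norm // rnorm_ge0.
Qed.

Definition scont s x := (fun y => inc B (s y)) @ x --> inc B (s x).

Lemma scontD s t x : scont s x -> scont t x -> scont (s + t) x.
Proof.
move=> sx tx; have := tadd_cvg (nbhs_filter x) _ _ sx tx.
rewrite !proj_inc tadd_inc => /(_ _ erefl) H; rewrite /scont.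
have -> : (fun y => inc B ((s + t) y)) = fun y => tadd (inc B (s y)) (inc B (t y)).
  by apply/funext => y; rewrite tadd_inc.
by apply: H => y; rewrite !proj_inc.
Qed.

Lemma scontZ k s x : scont s x -> scont (k *: s) x.
Proof.
move=> sx; have := tscale_cvg (k := k) sx.
rewrite tscale_inc /scont => H.
have -> : (fun y => inc B ((k *: s) y)) = fun y => tscale k (inc B (s y)) => //.
by apply/funext => y; rewrite tscale_inc.
Qed.

Lemma scont_near s x e : scont s x -> rnorm (s x) < e ->
  \forall y \near x, rnorm (s y) < e.
Proof.
move=> sx se; have : tnorm (inc B (s x)) < e by rewrite tnorm_inc.
by move/(tnorm_usc sx); apply: filterS => y; rewrite tnorm_inc.
Qed.

Lemma scont_null s x :
  (forall e, 0 < e -> \forall y \near x, rnorm (s y) <= e) -> scont s x.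
Proof.
move=> s0.
have sx0 : s x = 0.
  apply: (@rnorm_small_eq0 _ _ _ 1) => e e0; rewrite mul1r.
  exact: (nbhs_singleton (s0 e e0)).
rewrite /scont sx0; apply: tnull_cvg => [|e e0].
  by move=> N nN; apply: filterS nN => y; rewrite /= proj_inc.
by apply: filterS (s0 e e0) => y; rewrite tnorm_inc.
Qed.

Lemma scont0 x : scont 0 x.
Proof.
by apply: scont_null => e e0; apply: filterE => y; rewrite rnorm0 ltW.
Qed.

(** Scalar multiplication is jointly continuous although only continuity for
    fixed scalars is assumed: the error [(c y - c x) s y] tends to zero in norm,
    since [s] is locally bounded by upper semicontinuity. *)
Lemma scont_mulr (c : X -> R) s x :
  (forall e, 0 < e -> \forall y \near x, `|c y - c x| <= e) ->
  scont s x -> scont (fun y => (c y)%:C%C *: s y) x.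
Proof.
move=> cx sx; set t : section B := fun y => _.
have -> : t = (c x)%:C%C *: s + (t - (c x)%:C%C *: s) by rewrite addrC subrK.
apply: scontD; first exact: scontZ.
apply: scont_null => e e0; set M := rnorm (s x) + 1.
have M0 : 0 < M by rewrite ltr_wpDl ?rnorm_ge0.
have /(scont_near sx) sM : rnorm (s x) < M by rewrite /M; lra.
apply: filterS2 sM (cx (e / M) (divr_gt0 e0 M0)) => y yM yc.
change (rnorm ((c y)%:C%C *: s y - (c x)%:C%C *: s y) <= e); rewrite -scalerBl -rmorphB rnormZR.
by rewrite -[e](divfK (lt0r_neq0 M0)) ler_pM ?rnorm_ge0 // ltW.
Qed.

(** A section that is locally uniformly close to sections continuous at [x] is
    continuous at [x].  If [s y] stayed outside a neighbourhood of [s x] for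
    [y] arbitrarily near [x], then, [proj] being open, points [c] of the total
    space that tend to [s x] could be chosen over such [y]; the differences
    [s y - c] tend to zero in norm, so that [s y] would tend to [s x]. *)
Lemma scont_approx s x :
  (forall e, 0 < e -> exists2 t, scont t x &
     \forall y \near x, rnorm (s y - t y) <= e) -> scont s x.
Proof.
move=> sapp N nN; apply: contrapT => nsN.
pose bad c := ~ N (inc B (s (proj B c))).
pose H := within bad (nbhs (inc B (s x))).
have pH : proj B @ H --> x.
  apply: cvg_trans (cvg_app _ (cvg_within _)) _.
  have pc : proj B @ inc B (s x) --> proj B (inc B (s x)) by exact: proj_continuous.
  by rewrite proj_inc in pc.
have HP : ProperFilter H.
  split; last exact: within_filter.
  rewrite /H /within /= nbhsE => -[O [oO Os] Obad]; apply: nsN.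
  have pOx : (proj B @` O) x by exists (inc B (s x)); rewrite ?proj_inc.
  apply: filterS (open_nbhs_nbhs (conj (proj_open oO) pOx)) => _ [c Oc <-].
  by apply: contrapT => nNc; apply: Obad Oc _.
pose r c := inc B (s (proj B c) - vec B c).
have rH : r @ H --> inc B (0 : fib B x).
  apply: tnull_cvg => [|e e0].
    by move=> M /pH nM; apply: (@filterS _ H _ _ _ _ nM) => c; rewrite /= proj_inc.
  have [t tx st] := sapp (e / 3) (divr_gt0 e0 (ltr0Sn R 2)).
  have tp : (fun c => inc B (t (proj B c))) @ H --> inc B (t x).
    exact: cvg_comp pH tx.
  have idH : id @ H --> inc B (s x) by exact: cvg_within.
  have dH : (fun c => tadd (inc B (t (proj B c))) (tscale (-1) c)) @ H -->
      inc B (t x - s x).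
    rewrite -(scaleN1r (s x)) -tadd_inc -tscale_inc.
    apply: tadd_cvg => //; rewrite ?proj_inc ?/tscale ?proj_inc //.
    - by move=> c; rewrite !proj_inc.
    - exact: tscale_cvg.
  have [tsx tst] : rnorm (t x - s x) <= e / 3 /\
      \forall c \near H, rnorm (s (proj B c) - t (proj B c)) <= e / 3.
    by split; [rewrite rnorm_distC; exact: nbhs_singleton st|exact: pH st].
  have dn : tnorm (inc B (t x - s x)) < 2 * (e / 3) by rewrite tnorm_inc; lra.
  apply: filterS2 tst (tnorm_usc dH dn) => c sc; rewrite /r tnorm_inc.
  have -> : tadd (inc B (t (proj B c))) (tscale (-1) c) =
      inc B (t (proj B c) - vec B c).
    by rewrite /tscale tadd_inc scaleN1r.
  rewrite tnorm_inc => tc.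
  apply: (le_trans (rnorm_dist _ (t (proj B c)) _)); lra.
have : (fun c => tadd (r c) c) @ H --> tadd (inc B (0 : fib B x)) (inc B (s x)).
  apply: tadd_cvg => //; rewrite ?proj_inc //.
  - by move=> c; rewrite proj_inc.
  - exact: cvg_within.
rewrite tadd_inc add0r => /(_ _ nN) HN0.
have HN : H [set c | N (tadd (r c) c)] := HN0.
have : H bad by exact: withinT.
move/(filterI HN) => /filter_ex [c [/= Nc]]; apply.
move: Nc; congr N.
by have := tadd_inc (s (proj B c) - vec B c) (vec B c); rewrite vecK subrK => ->.
Qed.

End BanachBundle.

(** * Sections over open sets *)

Section Sections.
Variables (R : realType) (X : topologicalType) (B : banachBundle R X).
Implicit Types (U V K : set X) (s t : section B) (e : R) (x y : X) (b : bool).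

(** Both section spaces at once: [true] stands for compactly supported sections,
    [false] for sections vanishing at infinity.  Compact support is the decay
    condition for [e = 0]. *)
Definition asec b U : set (section B) :=
  [set s | [/\ forall x, ~ U x -> s x = 0,
    forall x, U x -> scont s x &
    forall e, (if b then 0 <= e else 0 < e) -> exists K,
      [/\ compact K, K `<=` U & forall x, ~ K x -> rnorm (s x) <= e]]].

Lemma csec_onP U s : open U ->
  continuous_section_on U s <-> forall x, U x -> scont s x.
Proof.
move=> oU; split=> [sc x Ux|sc]; last exact: open_cts_within.
exact: within_open_cts sc Ux.
Qed.

Lemma C0secE U : open U -> C0sec U = asec false U.
Proof.
move=> oU; apply/seteqP; split => s [s0 sc sK]; split => //; try exact/csec_onP.
- move=> e e0; have [K [cK KU Ks]] := sK e e0; exists K; split => // x nKx.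
  have [Ux|/s0 ->] := pselect (U x); first exact/ltW/Ks.
  by rewrite rnorm0 ltW.
- move=> e e0; have [K [cK KU Ks]] := sK (e / 2) (divr_gt0 e0 (ltr0Sn R 1)).
  by exists K; split => // x _ /Ks; move=> H; apply: (le_lt_trans H); lra.
Qed.

Lemma CcsecE U : open U -> Ccsec U = asec true U.
Proof.
move=> oU; apply/seteqP; split => s [s0 sc sK]; split => //; try exact/csec_onP.
- move=> e e0; have [K [cK KU Ks]] := sK; exists K; split => // x /Ks ->.
  by rewrite rnorm0.
- have [K [cK KU Ks]] := sK 0 (lexx 0); exists K; split => // x /Ks.
  exact: rnorm0_eq0.
Qed.

Lemma asec_sub b U s : asec true U s -> asec b U s.
Proof. by case: b => //; case=> s0 sc sK; split => // e /ltW/sK. Qed.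

Lemma asec0 b U : asec b U 0.
Proof.
split => // [x _|e e0]; first exact: scont0.
exists set0; split => // [|x _]; first exact: compact0.
by rewrite rnorm0; case: b e0 => // /ltW.
Qed.

Lemma asecD b U s t : asec b U s -> asec b U t -> asec b U (s + t).
Proof.
move=> [s0 sc sK] [t0 tc tK]; split => [x nUx|x Ux|e e0].
- by change (s x + t x = 0); rewrite s0 // t0 // addr0.
- by apply: scontD; [exact: sc|exact: tc].
have e2 : if b then 0 <= e / 2 else 0 < e / 2 by case: b e0 {sK tK}; lra.
have [K [cK KU Ks]] := sK _ e2; have [L [cL LU Lt]] := tK _ e2.
exists (K `|` L); split => [||x nKL]; first exact: compactU.
  by move=> x [/KU|/LU].
apply: (le_trans (rnormD _ _)).
have : rnorm (s x) <= e / 2 by apply: Ks => Kx; apply: nKL; left.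
have : rnorm (t x) <= e / 2 by apply: Lt => Lx; apply: nKL; right.
lra.
Qed.

Lemma asec_dom b U s t (C : R) : 0 < C -> asec b U s ->
  (forall x, U x -> scont t x) ->
  (forall x, rnorm (t x) <= C * rnorm (s x)) -> asec b U t.
Proof.
move=> C0 [s0 sc sK] tc tC; split => // [x nUx|e e0].
  by apply: rnorm0_eq0; rewrite (le_trans (tC x)) // s0 // rnorm0 mulr0.
have eC : if b then 0 <= e / C else 0 < e / C.
  by case: b e0 {sK}; [move=> ?; rewrite divr_ge0 // ltW|move=> ?; exact: divr_gt0].
have [K [cK KU Ks]] := sK _ eC; exists K; split => // x /Ks sx.
by apply: (le_trans (tC x)); rewrite mulrC -ler_pdivlMr.
Qed.

Lemma asecZ b U s (k : R[i]) : asec b U s -> asec b U (k *: s).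
Proof.
move=> sU; have [s0 sc sK] := sU.
apply: (@asec_dom _ _ _ _ (complex.Re `|k| + 1)) sU _ _ => [|x Ux|x].
- by rewrite ltr_wpDl // normc_def /= sqrtr_ge0.
- by apply: scontZ; exact: sc.
- change (rnorm (k *: s x) <= (complex.Re `|k| + 1) * rnorm (s x)).
  by rewrite rnormZ ler_wpM2r ?rnorm_ge0 // lerDl.
Qed.

Lemma asecN b U s : asec b U s -> asec b U (- s).
Proof. by rewrite -scaleN1r; exact: asecZ. Qed.

Lemma asecB b U s t : asec b U s -> asec b U t -> asec b U (s - t).
Proof. by move=> sU tU; apply: asecD => //; exact: asecN. Qed.

(** Sections over [U] stay continuous on larger Hausdorff sets: at a point
    outside [U] the complements of the compact subsets of [U] are
    neighbourhoods, so the section tends to zero there. *)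
Lemma asec_cont b U V s x : open U -> separated_on V -> U `<=` V ->
  asec b U s -> V x -> scont s x.
Proof.
move=> oU sV UV [s0 sc sK] Vx; have [Ux|nUx] := pselect (U x); first exact: sc.
apply: scont_null => e e0.
have [|K [cK KU Ks]] := sK e; first by case: b {sK} => //; exact: ltW.
have KV := subset_trans KU UV.
have nK : nbhs x (~` K) by apply: separated_compactC sV KV cK Vx _ => /KU.
by apply: filterS nK => y /Ks.
Qed.

Lemma asec_widen b U V s : open U -> separated_on V -> U `<=` V ->
  asec b U s -> asec b V s.
Proof.
move=> oU sV UV sU; have [s0 sc sK] := sU; split => [x nVx|x Vx|e /sK[K [cK KU Ks]]].
- by apply: s0 => /UV.
- exact: asec_cont sU Vx.
- by exists K; split => //; exact: subset_trans UV.
Qed.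

Lemma asec_bounded b U s : open U -> asec b U s ->
  exists2 M, 0 < M & forall x, rnorm (s x) <= M.
Proof.
move=> oU [s0 sc sK].
have [|K [cK KU Ks]] := sK 1; first by case: b {sK}.
pose Q (O : set X) := exists M, forall x, O x -> rnorm (s x) <= M.
have [|A1 A2 [M1 H1] [M2 H2]|x Kx|O KO [M OM]] := @compact_ind _ Q K cK.
- by exists 0.
- exists (Num.max M1 M2) => x [/H1|/H2] H; rewrite le_max H ?orbT //.
- exists [set y | rnorm (s y) < rnorm (s x) + 1].
    by apply: scont_near; [apply/sc/KU|rewrite ltrDl].
  by exists (rnorm (s x) + 1) => y /ltW.
exists (Num.max 1 M) => [|x]; first by rewrite lt_max ltr01.
have [/KO/OM|/Ks] := pselect (K x) => H; by rewrite le_max H ?orbT.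
Qed.

Lemma asec_level b U s e : open U -> asec b U s -> 0 < e ->
  compact [set x | e <= rnorm (s x)].
Proof.
move=> oU [s0 sc sK] e0.
have e2 : if b then 0 <= e / 2 else 0 < e / 2 by case: b {sK}; lra.
have [K [cK KU Ks]] := sK _ e2.
have oL : open [set x | U x /\ rnorm (s x) < e].
  rewrite openE => x [Ux sx]; apply: filterI; first exact: open_nbhs_nbhs.
  by apply: scont_near sx; exact: sc.
have -> : [set x | e <= rnorm (s x)] = K `&` ~` [set x | U x /\ rnorm (s x) < e].
  apply/seteqP; split => x /= => [ex|[Kx /not_andP[/(_ (KU _ Kx))//|/negP]]].
    split; last by case=> _; rewrite ltNge ex.
    apply: contrapT => /Ks; rewrite leNgt => /negP; apply; lra.
  by rewrite -leNgt.
by apply: compact_closedI => //; rewrite closedC.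
Qed.

End Sections.

(** * Bump functions and partitions of sections *)

Definition clamp (R : realType) (r : R) : R := Num.min 1 (Num.max 0 r).

Lemma clampP (R : realType) (r : R) : [\/ r <= 0 /\ clamp r = 0,
  0 <= r <= 1 /\ clamp r = r | 1 <= r /\ clamp r = 1].
Proof.
rewrite /clamp; case: (leP r 0) => r0.
  by constructor 1; split => //; case: (leP 1 0) => //; lra.
have [r1|r1] := leP 1 r; first by constructor 3.
by constructor 2; split => //; apply/andP; split; exact: ltW.
Qed.

Lemma clamp_lipschitz (R : realType) (a b e : R) :
  `|a - b| <= e / 4 -> `|clamp (2 - 4 * a) - clamp (2 - 4 * b)| <= e.
Proof.
rewrite !ler_norml => /andP[h1 h2].
by have [[? ->]|[/andP[? ?] ->]|[? ->]] := clampP (2 - 4 * a);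
  have [[? ->]|[/andP[? ?] ->]|[? ->]] := clampP (2 - 4 * b);
  apply/andP; split; lra.
Qed.

Section Bump.
Variables (R : realType) (G : etaleGroupoid).
Implicit Types (x y : G) (V W : set G).

(** Complete regularity of the unit space gives a bump function around [src x],
    which is pulled back along [src] on a slice contained in [W] and extended
    by zero; it is continuous on [V] because it vanishes off a compact subset of
    [V], which is closed in [V]. *)
Lemma bump_exists x V W : separated_on V -> W `<=` V -> open W -> W x ->
  exists (f : G -> R) (C : set G),
    [/\ compact C, C `<=` W, forall y, ~ C y -> f y = 0,
        forall y, 0 <= f y <= 1 & \forall y \near x, f y = 1] /\
      (forall y, V y -> forall e, 0 < e -> \forall z \near y, `|f z - f y| <= e).
Proof.
move=> sV WV oW Wx.
have [N [slN Nx NW]] := slice_basis (open_nbhs_nbhs (conj oW Wx)).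
have [oN sN rN] := slN.
pose T := set_type (units G).
pose u y : T := exist _ (src y) (mem_set (src_src y)).
have u_cts : continuous u.
  move=> y A; rewrite nbhsE => -[_ [[O oO <-] Oy] OA].
  have nO : nbhs y (@src G @^-1` O) by apply: src_cts; exact: open_nbhs_nbhs.
  by apply: filterS nO => z Oz; exact: OA.
pose O : set T := val @^-1` (@src G @` N).
have oO : open O by exists (@src G @` N) => //; exact: src_open.
have Ou : O (u x) by exists x.
have [D nD [cD clD]] := @units_locally_compact G (u x) I.
have {}nD : nbhs (u x) D.
  have nD' : nbhs (u x) [set z | [set: T] z -> D z] := nD.
  by apply: filterS nD' => z; apply.
have crT := locally_compact_completely_regular (R := R)
  (@units_locally_compact G) (@units_hausdorff G).
have clO : closed (~` (O `&` D°)).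
  by apply: open_closedC; apply: openI => //; exact: open_interior.
have [|f [fc f01 f0 f1]] := (uniform_separatorP (R := R) _ _).1 (crT (u x) _ clO _).
  by apply; split.
have fu : f (u x) = 0 by apply: f0; exists (u x).
have fout z : ~ (O z /\ D z) -> f z = 1.
  move=> nOD; apply: f1; exists z => // -[Oz Dz]; apply: nOD; split => //.
  exact: interior_subset.
(* [h] is 1 where [f <= 1/4] and 0 where [f >= 1/2], so it is constant near
   [u x] and supported in a compact set. *)
pose h (z : T) := clamp (2 - 4 * f z).
pose C' : set T := D `&` f @^-1` [set r | r <= 2^-1].
have cC' : compact C'.
  apply: compact_closedI => //; apply: closed_comp => [z _|]; first exact: fc.
  exact: closed_le.
have hC' z : ~ C' z -> h z = 0.
  move=> nC; have : 2^-1 <= f z.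
    have [Dz|nDz] := pselect (D z); last by rewrite fout => [|[]//]; lra.
    by rewrite leNgt; apply/negP => fz; apply: nC; split => //; exact: ltW.
  by move=> fz; rewrite /h; have [[? ->]|[/andP[? ?] ->]|[? ->]] := clampP (2 - 4 * f z); lra.
have C'O z : C' z -> O z.
  by move=> [_ /= fz]; apply: contrapT => nO; move: fz; rewrite fout => [|[]//]; lra.
pose g y := if pselect (N y) then h (u y) else 0.
have gN y : N y -> g y = h (u y) by rewrite /g; case: pselect.
pose C := (fun z : T => lift (@src G) N (val z)) @` C'.
have liftN y : N y -> lift (@src G) N (src y) = y.
  by move=> Ny; apply: liftE => // z Nz; exact: sN.
have gC y : ~ C y -> g y = 0.
  rewrite /g; case: pselect => // Ny nC; apply: hC' => C'u; apply: nC.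
  by exists (u y) => //=; exact: liftN.
have CN : C `<=` N.
  by move=> _ [z /C'O[y Ny yz] <-]; rewrite -yz liftN.
have cC : compact C.
  apply: continuous_compact => //; apply: open_cts_within => z /C'O[y Ny yz].
  apply: (@cvg_comp _ _ _ val _ _ (nbhs (val z))).
    exact: (@initial_continuous _ _ val).
  by rewrite -yz liftN //; apply: lift_cts => //; exact: src_local_homeo.
exists g, C; split; first split => //.
- exact: subset_trans NW.
- move=> y; have [/gN ->|nNy] := pselect (N y); last first.
    by rewrite gC ?lexx ?ler01 // => /CN.
  by rewrite /h; have [[? ->]|[/andP[? ?] ->]|[? ->]] := clampP (2 - 4 * f (u y));
    apply/andP; split; lra.
- have nf : nbhs x [set y | f (u y) < 4^-1].
    have : nbhs (f (u x)) [set r | r < 4^-1].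
      by apply: open_nbhs_nbhs; split; [exact: open_lt|rewrite /= fu; lra].
    by move/(fc (u x))/(u_cts x).
  apply: filterS2 (open_nbhs_nbhs (conj oN Nx)) nf => y Ny /= fy.
  rewrite gN // /h.
  by have [[? ->]|[/andP[? ?] ->]|[? ->]] := clampP (2 - 4 * f (u y)); lra.
- move=> y Vy e e0; have [Ny|nNy] := pselect (N y); last first.
    have nCy : ~ C y by move/CN.
    have CV : C `<=` V by move=> z /CN/NW/WV.
    apply: filterS (separated_compactC sV CV cC Vy nCy) => z /gC ->.
    by rewrite gC // subrr normr0 ltW.
  have nf : nbhs y [set z | `|f (u z) - f (u y)| <= e / 4].
    have e4 : 0 < e / 4 by lra.
    have nb : nbhs (u y) (f @^-1` ball (f (u y)) (e / 4)).
      exact: fc (nbhsx_ballx (f (u y)) (e / 4) e4).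
    have nb' : nbhs y (u @^-1` (f @^-1` ball (f (u y)) (e / 4))) := u_cts y _ nb.
    apply: filterS nb' => z; rewrite /= /ball /= distrC.
    exact: ltW.
  apply: filterS2 (open_nbhs_nbhs (conj oN Ny)) nf => z Nz /= fz.
  by rewrite !gN //; exact: clamp_lipschitz.
Qed.

End Bump.

Section Peeling.
Variables (R : realType) (G : etaleGroupoid) (B : banachBundle R G).
Implicit Types (x y : G) (V W K : set G) (s t p : section B).

(** Bump functions are peeled off one at a time.  Multiplication by [1 - f]
    neither increases norms nor destroys zeros, so the sets over which such a
    [p] exists are closed under finite unions, and compactness applies. *)
Lemma peel V (F : set (set G)) (P : set (section B)) K s :
  separated_on V -> compact K ->
  (forall W, F W -> open W /\ W `<=` V) ->
  (forall x, K x -> exists2 W, F W & W x) ->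
  P 0 -> (forall p q, P p -> P q -> P (p + q)) ->
  (forall W p, F W -> asec true W p -> P p) ->
  (forall p, P p -> forall x, V x -> scont p x) ->
  (forall x, V x -> scont s x) ->
  exists p, [/\ P p, forall x, K x -> p x = s x &
    forall x, rnorm (s x - p x) <= rnorm (s x)].
Proof.
move=> sV cK FV KF P0 PD PF Pc sc.
pose Q (O : set G) := forall s, (forall x, V x -> scont s x) ->
  exists p, [/\ P p, forall x, O x -> p x = s x &
    forall x, rnorm (s x - p x) <= rnorm (s x)].
have [|A1 A2 Q1 Q2 t tc|x Kx|O KO] := @compact_ind _ Q K cK.
- by move=> t tc; exists 0; split => // x; rewrite subr0.
- have [p [Pp pA p_le]] := Q1 t tc.
  have [|q [Pq qA q_le]] := Q2 (t - p).
    by move=> x Vx; apply: scontD; [exact: tc|rewrite -scaleN1r; apply/scontZ/Pc].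
  exists (p + q); split; first exact: PD.
    move=> x A12; change (p x + q x = t x); have [A1x|/qA ->] : A1 x \/ A2 x by [].
      suff -> : q x = 0 by rewrite addr0 pA.
      have := q_le x; change ((t - p) x) with (t x - p x); rewrite pA // subrr.
      by rewrite sub0r rnormN rnorm0 => /rnorm0_eq0.
    by change (p x + (t x - p x) = t x); rewrite addrC subrK.
  move=> x; change ((p + q) x) with (p x + q x); rewrite opprD addrA.
  exact: le_trans (q_le x) (p_le x).
- have [W FW Wx] := KF x Kx; have [oW WV] := FV W FW.
  have [f [C [[cC CW fC f01 f1] fc]]] := bump_exists R sV WV oW Wx.
  exists [set y | f y = 1] => // t tc.
  exists (fun y => (f y)%:C%C *: t y); split.
  + apply: (PF W) => //; split => [y nWy|y /WV Vy|e e0].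
    * by rewrite fC ?scale0r // => /CW.
    * by apply: scont_mulr; [exact: fc|exact: tc].
    * by exists C; split => // y /fC ->; rewrite scale0r rnorm0.
  + by move=> y /= ->; rewrite scale1r.
  + move=> y; rewrite -[X in X - _]scale1r -scalerBl -(rmorph1 (real_complex R)) -rmorphB.
    rewrite rnormZR.
    have /andP[f0 f1'] := f01 y.
    by rewrite ler_piMl ?rnorm_ge0 // ger0_norm; lra.
by move=> /(_ s sc)[p [Pp pO p_le]]; exists p; split => // x /KO; exact: pO.
Qed.

End Peeling.

(** * The section algebra of a Fell bundle *)

Section FellBundle.
Variables (R : realType) (G : etaleGroupoid) (B : fellBundle R G).
Local Notation T := (tot B).
Implicit Types (x y z : G) (U V W : set G) (s t : section B) (k : R[i]).

Lemma fiber_at_linear x y k (v w : fib B y) :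
  fiber_at x (inc B (k *: v + w)) =
  k *: fiber_at x (inc B v) + fiber_at x (inc B w).
Proof.
have [yx|yx] := pselect (y = x).
  by case: x / yx; rewrite !fiber_at_inc.
by rewrite !fiber_at_out ?proj_inc // scaler0 addr0.
Qed.

Lemma fiber_at_inc0 x y : fiber_at x (inc B (0 : fib B y)) = 0.
Proof.
by have := fiber_at_linear x (-1) (0 : fib B y) 0; rewrite scaler0 addr0 scaleN1r addNr.
Qed.

Lemma fiber_at_norm x y (v : fib B y) : y = x -> rnorm (fiber_at x (inc B v)) = rnorm v.
Proof. by move=> yx; case: x / yx; rewrite fiber_at_inc. Qed.

Section Fibrewise.
Variables x y : G.
Hypothesis xy : src x = rng y.

Lemma fmul0l (w : fib B y) : fmul B (0 : fib B x) w = 0.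
Proof.
by have := fmul_linearl (-1) (0 : fib B x) 0 w xy; rewrite scaler0 addr0 scaleN1r addNr.
Qed.

Lemma fmul0r (v : fib B x) : fmul B v (0 : fib B y) = 0.
Proof.
by have := fmul_linearr (-1) v (0 : fib B y) 0 xy; rewrite scaler0 addr0 scaleN1r addNr.
Qed.

End Fibrewise.

(** Associativity and the rules for the involution relate vectors of fibres
    that are only provably equal; they become equations between the following
    operations on the total space. *)
Definition tmul (a b : T) : T := inc B (fmul B (vec B a) (vec B b)).
Definition tstar (a : T) : T := inc B (fstar B (vec B a)).

Lemma tmul_inc x y (v : fib B x) (w : fib B y) :
  tmul (inc B v) (inc B w) = inc B (fmul B v w).
Proof.
apply: (vec_inc_ind (Q := fun z u => inc B (fmul B u (vec B (inc B w))) = _)).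
exact: (vec_inc_ind (Q := fun z u => inc B (fmul B v u) = inc B (fmul B v w))).
Qed.

Lemma tstar_inc x (v : fib B x) : tstar (inc B v) = inc B (fstar B v).
Proof. exact: (vec_inc_ind (Q := fun z u => inc B (fstar B u) = inc B (fstar B v))). Qed.

Lemma tmulA a b c : src (proj B a) = rng (proj B b) -> src (proj B b) = rng (proj B c) ->
  tmul a (tmul b c) = tmul (tmul a b) c.
Proof.
move=> ab bc; rewrite -{1}(vecK a) -{2}(vecK c) !tmul_inc.
exact: fmulA.
Qed.

Lemma tstarK : involutive tstar.
Proof. by move=> a; rewrite [X in tstar X]/tstar tstar_inc fstarK vecK. Qed.

Lemma tstarM a b : src (proj B a) = rng (proj B b) ->
  tstar (tmul a b) = tmul (tstar b) (tstar a).
Proof. by move=> ab; rewrite tstar_inc tmul_inc; exact: fstarM. Qed.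

Lemma inc_star s x : inc B (sec_star s x) = tstar (inc B (s (ginv x))).
Proof. by rewrite tstar_inc inc_fiber_at // proj_inc ginvK. Qed.

Lemma sec_star_norm s x : rnorm (sec_star s x) = rnorm (s (ginv x)).
Proof. by rewrite /sec_star fiber_at_norm ?ginvK // fstar_norm. Qed.

Lemma sec_star_linear k s t : sec_star (k *: s + t) = Num.conj k *: sec_star s + sec_star t.
Proof.
apply/functional_extensionality_dep => x.
change (sec_star (k *: s + t) x = Num.conj k *: sec_star s x + sec_star t x).
by rewrite /sec_star fstar_conj_linear fiber_at_linear.
Qed.

Lemma sec_star0 : sec_star (0 : section B) = 0.
Proof.
have := sec_star_linear (-1) (0 : section B) 0.
by rewrite scaler0 addr0 rmorphN1 scaleN1r addNr.
Qed.

Lemma sec_starD s t : sec_star (s + t) = sec_star s + sec_star t.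
Proof. by have := sec_star_linear 1 s t; rewrite rmorph1 !scale1r. Qed.

Lemma sec_starZ k s : sec_star (k *: s) = Num.conj k *: sec_star s.
Proof. by have := sec_star_linear k s 0; rewrite sec_star0 !addr0. Qed.

(** ** Convolution *)

Let term x s t (g : G * G) : fib B x := fiber_at x (inc B (fmul B (s g.1) (t g.2))).

Lemma conv_term0l x s t g : composable G g -> s g.1 = 0 -> term x s t g = 0.
Proof. by move=> cg s0; rewrite /term s0 fmul0l // fiber_at_inc0. Qed.

Lemma conv_term0r x s t g : composable G g -> t g.2 = 0 -> term x s t g = 0.
Proof. by move=> cg t0; rewrite /term t0 fmul0r // fiber_at_inc0. Qed.

(** The factorizations outside [U `*` V] contribute zero. *)
Lemma sec_mul_conv U V s t :
  (forall x, ~ U x -> s x = 0) -> (forall x, ~ V x -> t x = 0) ->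
  sec_mul U V s t = conv_on setT s t.
Proof.
move=> s0 t0; apply/functional_extensionality_dep => x; apply: fsbig_widen.
  by move=> g [].
move=> g /= [[_ cg gx] nUV]; have [Ug|/s0] := pselect (U g.1); last exact: conv_term0l.
have [Vg|/t0] := pselect (V g.2); last exact: conv_term0r.
by case: nUV.
Qed.

Lemma sec_mulE U V s t g : slice U -> slice V -> U g.1 -> V g.2 -> composable G g ->
  inc B (sec_mul U V s t (gmul g.1 g.2)) = tmul (inc B (s g.1)) (inc B (t g.2)).
Proof.
move=> [_ _ rU] [_ sV _] Ug Vg cg; rewrite /sec_mul /conv_on.
rewrite (_ : [set _ | _] = [set g]) ?fsbig_set1.
  by rewrite inc_fiber_at ?proj_inc // tmul_inc.
apply/seteqP; split => [[h1 h2] [/= [Uh Vh] ch hg]|_ -> //].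
have gh1 : h1 = g.1 by apply: rU => //; rewrite -(rng_mul ch) hg rng_mul.
have gh2 : h2 = g.2 by apply: sV => //; rewrite -(src_mul ch) hg src_mul.
by rewrite gh1 gh2; case: (g).
Qed.

Lemma sec_mul_out U V s t x : ~ bmul U V x -> sec_mul U V s t x = 0.
Proof.
move=> nx; rewrite /sec_mul /conv_on (_ : [set _ | _] = set0) ?fsbig_set0 //.
rewrite -subset0 => g [UVg cg gx]; apply: nx; exists g => //.
Qed.

(** This makes convolution a finite sum: an arrow [x] and a left factor of [x]
    with range [rng x] determine the right factor. *)
Definition fin_fibred s := forall y, finite_set [set g : G | rng g = y /\ s g != 0].

Lemma fin_fibredD s t : fin_fibred s -> fin_fibred t -> fin_fibred (s + t).
Proof.
move=> fs ft y; apply: (@sub_finite_set _ _ ([set g | rng g = y /\ s g != 0] `|`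
    [set g | rng g = y /\ t g != 0])); last by rewrite finite_setU.
move=> g /= [gy]; have [sg|] := eqVneq (s g) 0; last by left.
by change ((s + t) g) with (s g + t g); rewrite sg add0r; right.
Qed.

Lemma slice_fin_fibred U s : slice U -> (forall x, ~ U x -> s x = 0) -> fin_fibred s.
Proof.
move=> [_ _ rU] s0 y.
apply: (@sub_finite_set _ _ [set lift (@rng G) U y]); last exact: finite_set1.
move=> g /= [<- sg]; have Ug : U g.
  by apply: contrapT => /s0 E; rewrite E eqxx in sg.
by rewrite liftE // => h Uh; exact: rU.
Qed.

Let finite_factor x s : fin_fibred s -> finite_set [set g : G * G |
  [/\ setT g, composable G g & gmul g.1 g.2 = x] /\ s g.1 != 0].
Proof.
move=> /(_ (rng x)) /(finite_image (fun g => (g, gmul (ginv g) x))).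
apply: sub_finite_set => -[g h] /= [[_ cg gx] sg]; exists g.
  by split => //; rewrite -gx rng_mul.
by rewrite -(gmul_mulVl cg gx).
Qed.

Let conv_finite x s t (D : set (G * G)) : finite_set D ->
  D `<=` [set g | [/\ setT g, composable G g & gmul g.1 g.2 = x]] ->
  (forall g, composable G g -> gmul g.1 g.2 = x -> ~ D g -> s g.1 = 0) ->
  conv_on setT s t x = \sum_(g <- finmap.enum_fset (fset_set D)) term x s t g.
Proof.
move=> fD DA sD; rewrite /conv_on -fsbig_finite //; apply/esym/fsbig_widen => //.
by move=> g [[_ cg gx] nD]; apply: conv_term0l => //; exact: sD.
Qed.

Lemma conv_linearl k s s' t : fin_fibred s -> fin_fibred s' ->
  conv_on setT (k *: s + s') t = k *: conv_on setT s t + conv_on setT s' t.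
Proof.
move=> fs fs'; apply/functional_extensionality_dep => x.
change (conv_on setT (k *: s + s') t x = k *: conv_on setT s t x + conv_on setT s' t x).
set A := [set g | [/\ setT g, composable G g & gmul g.1 g.2 = x]].
pose D := [set g : G * G | A g /\ s g.1 != 0] `|` [set g | A g /\ s' g.1 != 0].
have fD : finite_set D by rewrite finite_setU; split; exact: finite_factor.
have DA : D `<=` A by move=> g [[]|[]].
have nD g : composable G g -> gmul g.1 g.2 = x -> ~ D g -> s g.1 = 0 /\ s' g.1 = 0.
  move=> cg gx nDg; split; apply: contrapT => /eqP n0; apply: nDg; [left|right]; by split.
rewrite !(conv_finite _ fD DA) //.
- rewrite scaler_sumr -big_split /= big_seq [RHS]big_seq; apply: eq_bigr => g.
  rewrite in_fset_set // => /set_mem/DA[_ cg _].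
  by rewrite /term -fiber_at_linear -fmul_linearl.
- by move=> g cg gx /(nD _ cg gx)[].
- by move=> g cg gx /(nD _ cg gx)[].
- move=> g cg gx /(nD _ cg gx)[s0 s0'].
  by change (k *: s g.1 + s' g.1 = 0); rewrite s0 s0' scaler0 addr0.
Qed.

Lemma conv_linearr k s t t' : fin_fibred s ->
  conv_on setT s (k *: t + t') = k *: conv_on setT s t + conv_on setT s t'.
Proof.
move=> fs; apply/functional_extensionality_dep => x.
change (conv_on setT s (k *: t + t') x = k *: conv_on setT s t x + conv_on setT s t' x).
set A := [set g | [/\ setT g, composable G g & gmul g.1 g.2 = x]].
pose D := [set g : G * G | A g /\ s g.1 != 0].
have fD : finite_set D by exact: finite_factor.
have DA : D `<=` A by move=> g [].
have nD g : composable G g -> gmul g.1 g.2 = x -> ~ D g -> s g.1 = 0.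
  by move=> cg gx nDg; apply: contrapT => /eqP n0; apply: nDg.
rewrite !(conv_finite _ fD DA) // scaler_sumr -big_split /=.
rewrite big_seq [RHS]big_seq; apply: eq_bigr => g.
rewrite in_fset_set // => /set_mem/DA[_ cg _].
by rewrite /term -fiber_at_linear -fmul_linearr.
Qed.

End FellBundle.

(** * Products and adjoints of sections over slices *)

Section SliceSections.
Variables (R : realType) (G : etaleGroupoid) (B : fellBundle R G).
Implicit Types (x y z : G) (U V W E : set G) (s t h : section B) (b : bool).

Lemma binvE U : binv U = @ginv G @^-1` U.
Proof.
apply/seteqP; split => [_ [x Ux <-]|x Ux] /=; first by rewrite ginvK.
by exists (ginv x) => //; rewrite ginvK.
Qed.

Lemma asec_star b U s : slice U -> asec b U s -> asec b (binv U) (sec_star s).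
Proof.
rewrite binvE => slU [s0 sc sK]; split => [x nU|x Ux|e /sK[K [cK KU Ks]]].
- by apply: rnorm0_eq0; rewrite sec_star_norm s0 // rnorm0.
- rewrite /scont inc_star.
  have -> : (fun y => inc B (sec_star s y)) = @tstar _ _ B \o (fun y => inc B (s (ginv y))).
    by apply/funext => y; rewrite inc_star.
  apply: (@cvg_comp _ _ _ _ _ _ (nbhs (inc B (s (ginv x))))); last exact: fstar_continuous.
  apply: (@cvg_comp _ _ _ (@ginv G) (fun y => inc B (s y)) _ (nbhs (ginv x))).
    exact: ginv_continuous.
  exact: sc.
exists (@ginv G @^-1` K); split => [|x|x nK].
- rewrite -binvE; apply: continuous_compact => //.
  by apply: open_cts_within => x _; exact: ginv_continuous.
- exact: KU.
- by rewrite sec_star_norm; exact: Ks.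
Qed.

Lemma sec_mul_norm U V s t (g : G * G) : slice U -> slice V ->
  U g.1 -> V g.2 -> composable G g ->
  rnorm (sec_mul U V s t (gmul g.1 g.2)) <= rnorm (s g.1) * rnorm (t g.2).
Proof.
move=> slU slV Ug Vg cg; rewrite -tnorm_inc sec_mulE // tmul_inc tnorm_inc.
exact: fmul_norm.
Qed.

Lemma sec_mul_le U V s t (M N : R) x : slice U -> slice V -> 0 <= M -> 0 <= N ->
  (forall x, rnorm (s x) <= M) -> (forall x, rnorm (t x) <= N) ->
  rnorm (sec_mul U V s t x) <= M * N.
Proof.
move=> slU slV M0 N0 sM tN; have [[g [[Ug Vg] cg] <-]|/sec_mul_out ->] := pselect (bmul U V x).
  by apply: (le_trans (sec_mul_norm _ _ slU slV Ug Vg cg)); rewrite ler_pM ?rnorm_ge0.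
by rewrite rnorm0 mulr_ge0.
Qed.

(** On [bmul U V] the two factors of an arrow depend continuously on it, by way
    of its range and its source. *)
Lemma sec_mul_scont U V s t x : slice U -> slice V -> open (bmul U V) ->
  (forall x, U x -> scont s x) -> (forall x, V x -> scont t x) ->
  bmul U V x -> scont (sec_mul U V s t) x.
Proof.
move=> slU slV oUV sc tc UVx; have [oU _ rU] := slU; have [oV sV _] := slV.
have [g [[Ug Vg] cg] gx] := UVx.
pose f y := lift (@rng G) U (rng y); pose h y := lift (@src G) V (src y).
have fh g' : U g'.1 -> V g'.2 -> composable G g' ->
    f (gmul g'.1 g'.2) = g'.1 /\ h (gmul g'.1 g'.2) = g'.2.
  move=> Ug' Vg' cg'; rewrite /f /h rng_mul // src_mul //; split; apply: liftE => //.
    by move=> y Uy; exact: rU.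
  by move=> y Vy; exact: sV.
have [fx hx] := fh g Ug Vg cg.
have fc : f @ x --> g.1.
  apply: (@cvg_comp _ _ _ (@rng G) _ _ (nbhs (rng x))); first exact: rng_cts.
  by rewrite -gx rng_mul //; apply: lift_cts => //; exact: rng_local_homeo.
have hc : h @ x --> g.2.
  apply: (@cvg_comp _ _ _ (@src G) _ _ (nbhs (src x))); first exact: src_cts.
  by rewrite -gx src_mul //; apply: lift_cts => //; exact: src_local_homeo.
move=> N; rewrite -gx sec_mulE // => nN.
have cp : composable G (proj B (inc B (s g.1)), proj B (inc B (t g.2))).
  by rewrite !proj_inc.
have H := within_cts_at (x := (inc B (s g.1), inc B (t g.2))) (@fmul_continuous _ _ B) cp nN.
have sf : (fun y => inc B (s (f y))) @ x --> inc B (s g.1).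
  by apply: (@cvg_comp _ _ _ f (fun y => inc B (s y)) _ (nbhs g.1)) => //; exact: sc.
have th : (fun y => inc B (t (h y))) @ x --> inc B (t g.2).
  by apply: (@cvg_comp _ _ _ h (fun y => inc B (t y)) _ (nbhs g.2)) => //; exact: tc.
have HN' : nbhs x [set y |
    composable G (proj B (inc B (s (f y))), proj B (inc B (t (h y)))) ->
    N (tmul (inc B (s (f y))) (inc B (t (h y))))] by exact: (cvg_pair sf th H).
have nUV : nbhs x (bmul U V) by exact: open_nbhs_nbhs.
rewrite gx; change (nbhs x [set y | N (inc B (sec_mul U V s t y))]).
apply: filterS2 nUV HN' => _ [g' [[Ug' Vg'] cg'] <-] /=.
have [-> ->] := fh g' Ug' Vg' cg'; rewrite !proj_inc sec_mulE //.
by apply.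
Qed.

(** The products of compact sets [K] and [L] in slices form a compact set, the
    image of [{g in K | src g in rng L}], which is closed in [K] because
    units can be separated. *)
Lemma bmul_compact V K L : slice V -> L `<=` V -> compact K -> compact L ->
  compact (bmul K L).
Proof.
move=> slV LV cK cL; have [oV _ rV] := slV.
pose l g := lift (@rng G) V (src g).
have lE g k : V k -> src g = rng k -> l g = k.
  by move=> Vh gh; rewrite /l gh liftE // => y Vy; exact: rV.
have cM : compact (@rng G @` L).
  by apply: continuous_compact => //; apply: open_cts_within => x _; exact: rng_cts.
have clM : closed (@src G @^-1` (@rng G @` L)).
  rewrite -openC openE => x nx.
  suff nb : nbhs (src x) (~` (@rng G @` L)) by exact: src_cts nb.
  apply: separated_compactC (@units_separated G) _ cM _ nx; last exact: src_src.
  by move=> _ [y _ <-]; exact: src_rng.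
have -> : bmul K L = (fun g => gmul g (l g)) @` (K `&` (@src G @^-1` (@rng G @` L))).
  apply/seteqP; split => [_ [g [[Kg Lg] cg] <-]|_ [g [Kg [k Lh gh]] <-]].
    by exists g.1; [split => //; exists g.2|rewrite (lE _ g.2) //; exact: LV].
  have -> : l g = k by apply: lE => //; exact: LV.
  by exists (g, k).
apply: continuous_compact; last exact: compact_closedI.
apply: open_cts_within => g [Kg [k Lh gh]].
have Vh := LV _ Lh; have lg : l g = k by exact: lE.
have lc : l @ g --> l g.
  rewrite lg; apply: (@cvg_comp _ _ _ (@src G) _ _ (nbhs (src g))); first exact: src_cts.
  by rewrite -gh; apply: lift_cts => //; exact: rng_local_homeo.
move=> N nN.
have cg : composable G (g, l g) by rewrite lg.
have H := within_cts_at (x := (g, l g)) (@gmul_continuous G) cg nN.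
have HN' : nbhs g [set y | composable G (y, l y) -> N (gmul y (l y))].
  exact: (cvg_pair (@cvg_id _ (nbhs g)) lc H).
have nV : nbhs g (@src G @^-1` (@rng G @` V)).
  apply: src_cts; apply: open_nbhs_nbhs; split; first exact: rng_open.
  by exists k.
change (nbhs g [set y | N (gmul y (l y))]).
apply: filterS2 nV HN' => y [k' Vk' yk'] /=; apply.
by rewrite /composable /= (lE _ k').
Qed.

Lemma asec_mul b U V s t : slice U -> slice V -> open (bmul U V) ->
  asec b U s -> asec b V t -> asec b (bmul U V) (sec_mul U V s t).
Proof.
move=> slU slV oUV sU tV; have [s0 sc sK] := sU; have [t0 tc tK] := tV.
have [oU _ _] := slU; have [oV _ _] := slV.
split => [x|x|e e0]; [exact: sec_mul_out|exact: sec_mul_scont|].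
have [M M0 sM] := asec_bounded oU sU; have [N N0 tN] := asec_bounded oV tV.
have eMN C : 0 < C -> if b then 0 <= e / C else 0 < e / C.
  by case: b e0 {sK tK sU tV} => e0 C0; [rewrite divr_ge0 // ltW|exact: divr_gt0].
have [K [cK KU Ks]] := sK _ (eMN N N0); have [L [cL LV Lt]] := tK _ (eMN M M0).
exists (bmul K L); split; first exact: bmul_compact slV LV cK cL.
  by move=> _ [g [[Kg Lg] cg] <-]; exists g => //; split => //; split; [exact: KU|exact: LV].
move=> x nKL; have e0' : 0 <= e by case: b e0 {sK tK sU tV eMN} => // /ltW.
have [[g [[Ug Vg] cg] gx]|/sec_mul_out ->] := pselect (bmul U V x); last by rewrite rnorm0.
rewrite -gx; apply: (le_trans (sec_mul_norm _ _ slU slV Ug Vg cg)).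
have [Kg|/Ks sg] := pselect (K g.1).
  have /Lt tg : ~ L g.2 by move=> Lg; apply: nKL; exists g.
  by rewrite -[e](divfK (lt0r_neq0 M0)) mulrC ler_pM ?rnorm_ge0.
by rewrite -[e](divfK (lt0r_neq0 N0)) ler_pM ?rnorm_ge0.
Qed.

(** ** Sections over units *)

(** The fibre over a unit [x] is a C*-algebra; since [gmul x x] and [ginv x] are
    only provably equal to [x], its operations are transported. *)
Definition unit_mul x (v w : fib B x) : fib B x := fiber_at x (inc B (fmul B v w)).
Definition unit_star x (v : fib B x) : fib B x := fiber_at x (inc B (fstar B v)).

Section UnitFibre.
Variable x : G.
Hypothesis xu : src x = x.

Let xc : src x = rng x.
Proof. by rewrite unit_rng. Qed.

Lemma inc_unit_mul (v w : fib B x) : inc B (unit_mul v w) = tmul (inc B v) (inc B w).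
Proof. by rewrite inc_fiber_at ?tmul_inc // proj_inc gmul_unit. Qed.

Lemma inc_unit_star (v : fib B x) : inc B (unit_star v) = tstar (inc B v).
Proof. by rewrite inc_fiber_at ?tstar_inc // proj_inc unit_inv. Qed.

Fact unit_mulA : associative (@unit_mul x).
Proof.
move=> u v w; apply: (@Defs.inc_inj _ _ B).
by rewrite !inc_unit_mul tmulA ?proj_inc.
Qed.

Fact unit_linearl k (a a' b : fib B x) :
  unit_mul (k *: a + a') b = k *: unit_mul a b + unit_mul a' b.
Proof. by rewrite /unit_mul fmul_linearl // fiber_at_linear. Qed.

Fact unit_linearr k (a b b' : fib B x) :
  unit_mul a (k *: b + b') = k *: unit_mul a b + unit_mul a b'.
Proof. by rewrite /unit_mul fmul_linearr // fiber_at_linear. Qed.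

Fact unit_star_conj_linear k (a a' : fib B x) :
  unit_star (k *: a + a') = Num.conj k *: unit_star a + unit_star a'.
Proof. by rewrite /unit_star fstar_conj_linear fiber_at_linear. Qed.

Fact unit_starK : involutive (@unit_star x).
Proof. by move=> v; apply: (@Defs.inc_inj _ _ B); rewrite !inc_unit_star tstarK. Qed.

Fact unit_starM (a b : fib B x) :
  unit_star (unit_mul a b) = unit_mul (unit_star b) (unit_star a).
Proof.
apply: (@Defs.inc_inj _ _ B).
by rewrite !(inc_unit_mul, inc_unit_star) tstarM ?proj_inc.
Qed.

Fact unit_mul_norm (a b : fib B x) : rnorm (unit_mul a b) <= rnorm a * rnorm b.
Proof. by rewrite /unit_mul fiber_at_norm ?gmul_unit // fmul_norm. Qed.

Fact unit_cstar_norm (a : fib B x) : rnorm (unit_mul (unit_star a) a) = rnorm a ^+ 2.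
Proof.
rewrite -tnorm_inc inc_unit_mul inc_unit_star tstar_inc tmul_inc tnorm_inc.
exact: fcstar.
Qed.

Definition unit_cstar : cstarAlgebra R :=
  CstarAlgebra unit_mulA unit_linearl unit_linearr unit_star_conj_linear
    unit_starK unit_starM unit_mul_norm unit_cstar_norm.

End UnitFibre.

End SliceSections.

(** * Boundedness of representations *)

Section UnitSections.
Variables (R : realType) (G : etaleGroupoid) (B : fellBundle R G).
Variables (b : bool) (E : set G).
Hypotheses (oE : open E) (Eu : E `<=` units G).
Implicit Types (s t h : section B) (x : G).

Lemma unit_slice : slice E.
Proof.
split => // x y /Eu xu /Eu yu; first by rewrite xu yu.
by rewrite !unit_rng.
Qed.

Lemma bmul_units : bmul E E = E.
Proof.
apply/seteqP; split => [_ [g [[Eg Eg'] cg] <-]|x Ex].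
  have <- : g.1 = g.2 by rewrite -(Eu Eg) cg unit_rng //; exact: Eu.
  by rewrite gmul_unit //; exact: Eu.
exists (x, x); last by rewrite /= gmul_unit //; exact: Eu.
by split => //=; rewrite /composable /= unit_rng //; exact: Eu.
Qed.

Lemma binv_units : binv E = E.
Proof.
apply/seteqP; split => [_ [x Ex <-]|x Ex]; first by rewrite unit_inv //; exact: Eu.
by exists x => //; rewrite unit_inv //; exact: Eu.
Qed.

Lemma sec_mul_unit s t x : E x -> sec_mul E E s t x = unit_mul (s x) (t x).
Proof.
move=> Ex; have xu := Eu Ex; apply: (@Defs.inc_inj _ _ B).
rewrite (inc_unit_mul xu).
have := @sec_mulE _ _ _ E E s t (x, x) unit_slice unit_slice Ex Ex.
by rewrite /= (gmul_unit xu); apply; rewrite /composable /= unit_rng.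
Qed.

Lemma sec_star_unit s x : E x -> sec_star s x = unit_star (s x).
Proof.
move=> /Eu xu; apply: (@Defs.inc_inj _ _ B).
by rewrite inc_star (inc_unit_star xu) unit_inv.
Qed.

Lemma asec_mul_units s t : asec b E s -> asec b E t -> asec b E (sec_mul E E s t).
Proof.
move=> sE tE; rewrite -{1}bmul_units.
apply: asec_mul => //; [exact: unit_slice|exact: unit_slice|by rewrite bmul_units].
Qed.

(** A square root is extracted fibrewise; its continuity is that of a uniform
    limit. *)
Lemma section_root h : asec b E h -> sec_star h = h ->
  (forall x, rnorm (h x) <= 2^-1) ->
  exists k, [/\ asec b E k, sec_star k = k, sec_mul E E h k = sec_mul E E k h &
    k + k - sec_mul E E k k = sec_mul E E h h].
Proof.
move=> hE hs h2; have [h0 _ _] := hE.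
pose kn := fix kn n : section B :=
  if n is n'.+1 then (2^-1)%:C%C *: (sec_mul E E h h + sec_mul E E (kn n') (kn n'))
  else 0.
have knE n : asec b E (kn n).
  elim: n => [|n IH] /=; first exact: asec0.
  by apply: asecZ; apply: asecD; exact: asec_mul_units.
have kn_iter n x (Ex : E x) : kn n x = @root_iter _ (unit_cstar B (Eu Ex)) (h x) n.
  elim: n => [|n IH] //=.
  by rewrite -[LHS]/(_ *: (sec_mul E E h h x + _)) !sec_mul_unit // IH.
(* [k] is chosen pointwise together with its distance to the iterates, which is
   uniform in [x]. *)
have /(fun H x => cid (H x)) kx : forall x, exists v : fib B x, (~ E x -> v = 0) /\
    (E x -> [/\ forall n, rnorm (v - kn n x) <= 2 * (2^-1) ^+ n, unit_star v = v,
      unit_mul v (h x) = unit_mul (h x) v, rnorm v <= rnorm (h x) &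
      v + v - unit_mul v v = unit_mul (h x) (h x)]).
  move=> x; have [Ex|nEx] := pselect (E x); last by exists 0.
  have hxs : cs_star (unit_cstar B (Eu Ex)) (h x) = h x.
    by rewrite -[RHS](congr1 (fun s => s x) hs) sec_star_unit.
  have [v [v1 v2 v3 v4 v5]] := @cs_root _ (unit_cstar B (Eu Ex)) _ hxs (h2 x).
  exists v; split => // _; split => // n.
  by rewrite (kn_iter n x Ex).
pose k : section B := fun x => sval (kx x).
have k0 x : ~ E x -> k x = 0 by rewrite /k; case: (kx x) => v [].
have kE x : E x -> [/\ forall n, rnorm (k x - kn n x) <= 2 * (2^-1) ^+ n,
    unit_star (k x) = k x, unit_mul (k x) (h x) = unit_mul (h x) (k x),
    rnorm (k x) <= rnorm (h x) &
    k x + k x - unit_mul (k x) (k x) = unit_mul (h x) (h x)].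
  by rewrite /k; case: (kx x) => v [].
have bE x : ~ E x -> forall s t, sec_mul E E s t x = 0.
  by move=> nEx s t; apply: sec_mul_out; rewrite bmul_units.
exists k; split.
- apply: (@asec_dom _ _ _ _ _ h k 1) => // [x Ex|x]; last first.
    rewrite mul1r; have [/kE[]//|/k0 ->] := pselect (E x).
    by rewrite rnorm0 rnorm_ge0.
  apply: scont_approx => e /geometric_small[n ne]; exists (kn n).
    by have [_ sc _] := knE n; exact: sc.
  apply: filterS (open_nbhs_nbhs (conj oE Ex)) => y /kE[kn_le _ _ _ _].
  exact: le_trans (kn_le n) ne.
- apply/functional_extensionality_dep => x.
  have [Ex|nEx] := pselect (E x); first by rewrite sec_star_unit //; case: (kE x Ex).
  have nEi : ~ E (ginv x) by rewrite -[E _]/((@ginv G @^-1` E) x) -binvE binv_units.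
  by rewrite (k0 _ nEx); apply: rnorm0_eq0; rewrite sec_star_norm (k0 _ nEi) rnorm0.
- apply/functional_extensionality_dep => x.
  have [Ex|nEx] := pselect (E x); last by rewrite !bE.
  by rewrite !sec_mul_unit //; case: (kE x Ex).
- apply/functional_extensionality_dep => x.
  change (k x + k x - sec_mul E E k k x = sec_mul E E h h x).
  have [Ex|nEx] := pselect (E x); last by rewrite !bE // (k0 _ nEx) addr0 subr0.
  by rewrite !sec_mul_unit //; case: (kE x Ex).
Qed.

End UnitSections.

Section Representation.
Variables (R : realType) (G : etaleGroupoid) (B : fellBundle R G) (b : bool).
Variables (S : set (set G)) (D : cstarAlgebra R) (T : set G -> section B -> D).

(** Representations of the Fell bundle of sections over the members of [S]. *)
Definition bundle_rep : Prop :=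
  [/\ forall U (k : R[i]) s t, S U -> asec b U s -> asec b U t ->
        T U (k *: s + t) = k *: T U s + T U t,
      forall U V s t, S U -> S V -> asec b U s -> asec b V t ->
        T (bmul U V) (sec_mul U V s t) = cs_mul D (T U s) (T V t),
      forall U s, S U -> asec b U s -> T (binv U) (sec_star s) = cs_star D (T U s) &
      forall U V s, S U -> S V -> U `<=` V -> asec b U s -> T U s = T V s].

Hypotheses (S_inv : inverse_subsemigroup S) (T_rep : bundle_rep).
Implicit Types (U V E : set G) (s t h : section B).

Lemma S_slice U : S U -> slice U.
Proof. by case: S_inv => Sb _ _ /Sb/bissection_slice. Qed.

Lemma S_open U : S U -> open U.
Proof. by move=> /S_slice[]. Qed.

Lemma rep0 U : S U -> T U 0 = 0.
Proof.
move=> SU; have [lin _ _ _] := T_rep.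
have := lin U (-1) 0 0 SU (asec0 _ _ _) (asec0 _ _ _).
by rewrite scaler0 addr0 scaleN1r addNr.
Qed.

Lemma repD U s t : S U -> asec b U s -> asec b U t -> T U (s + t) = T U s + T U t.
Proof.
move=> SU sU tU; have [lin _ _ _] := T_rep.
by have := lin U 1 s t SU sU tU; rewrite !scale1r.
Qed.

Lemma repZ U k s : S U -> asec b U s -> T U (k *: s) = k *: T U s.
Proof.
move=> SU sU; have [lin _ _ _] := T_rep.
by have := lin U k s 0 SU sU (asec0 _ _ _); rewrite !addr0 rep0 // addr0.
Qed.

Lemma repB U s t : S U -> asec b U s -> asec b U t -> T U (s - t) = T U s - T U t.
Proof.
move=> SU sU tU; rewrite repD //; last exact: asecN.
by rewrite -scaleN1r repZ // scaleN1r.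
Qed.

(** [T] carries the root of [h] to an element to which [cs_unitary_norm]
    applies. *)
Lemma rep_units_le1 E h : S E -> E `<=` units G -> asec b E h -> sec_star h = h ->
  (forall x, rnorm (h x) <= 2^-1) -> rnorm (T E h) <= 1.
Proof.
move=> SE Eu hE hs h2; have [_ mul star _] := T_rep; have oE := S_open SE.
have [k [kE ks hk kk]] := section_root oE Eu hE hs h2.
have starE s : asec b E s -> T E (sec_star s) = cs_star D (T E s).
  by move=> sE; rewrite -star // binv_units.
have mulE s t : asec b E s -> asec b E t ->
    T E (sec_mul E E s t) = cs_mul D (T E s) (T E t).
  by move=> sE tE; rewrite -mul // bmul_units.
have mE s t : asec b E s -> asec b E t -> asec b E (sec_mul E E s t).
  exact: asec_mul_units.
apply: (cs_unitary_norm (k := T E k)).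
- by rewrite -starE ?hs.
- by rewrite -starE ?ks.
- by rewrite -!mulE // hk.
- by rewrite -!mulE // -kk repB ?repD //; [exact: asecD|exact: mE].
Qed.

(** The C*-identity reduces the bound to the section [s^* s], which lives over
    units. *)
Lemma rep_bound U s M : S U -> asec b U s -> 0 < M ->
  (forall x, rnorm (s x) <= M) -> rnorm (T U s) <= 2 * M.
Proof.
move=> SU sU M0 sM; have [_ Smul Sinv] := S_inv; have [_ mul star _] := T_rep.
have slU := S_slice SU; have [oU sI rI] := slU.
have SV := Sinv _ SU; have slV := S_slice SV.
set V := binv U in SV slV; pose E := bmul V U.
have SE : S E by exact: Smul.
have EE x : E x -> exists2 u, U u & x = src u.
  move=> [[v u] [[[w Uw /= <-] /= Uu] cwu] <-]; exists u => //=.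
  have -> : w = u by apply: rI => //; rewrite -cwu /= src_inv.
  exact: gmulVl.
have Eu : E `<=` units G by move=> x /EE[u _ ->]; exact: src_src.
have ssV := asec_star slU sU.
pose h := sec_mul V U (sec_star s) s.
have hE : asec b E h by apply: asec_mul => //; exact: S_open.
have hM x : rnorm (h x) <= M * M.
  by apply: sec_mul_le => //; try exact: ltW; move=> y; rewrite sec_star_norm.
have h_src u : U u -> inc B (h (src u)) = tmul (tstar (inc B (s u))) (inc B (s u)).
  move=> Uu; rewrite -gmulVl; have := @sec_mulE _ _ _ V U (sec_star s) s (ginv u, u).
  move=> -> //=; first by rewrite inc_star ginvK.
    by exists u.
  by rewrite /composable /= src_inv.
have hs : sec_star h = h.
  apply/functional_extensionality_dep => x.
  have [Ex|nEx] := pselect (E x).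
    apply: (@Defs.inc_inj _ _ B); rewrite inc_star unit_inv; last exact: Eu.
    have [u Uu ->] := EE x Ex; rewrite h_src // tstarM ?tstarK //.
    by rewrite /tstar !proj_inc src_inv.
  have nEi : ~ E (ginv x).
    move=> Ei; apply: nEx; have := unit_inv (Eu _ Ei).
    by rewrite ginvK => ->.
  have [h0 _ _] := hE; rewrite (h0 _ nEx); apply: rnorm0_eq0.
  by rewrite sec_star_norm (h0 _ nEi) rnorm0.
(* the factor that brings the norm of [h] below 1/2 *)
pose c : R := (2 * (M * M))^-1.
have c0 : 0 < c by rewrite invr_gt0 !mulr_gt0.
have TE : rnorm (T E (c%:C%C *: h)) <= 1.
  apply: rep_units_le1 => //; first exact: asecZ.
    by rewrite sec_starZ conjCR hs.
  move=> x; change (rnorm (c%:C%C *: h x) <= 2^-1); rewrite rnormZR gtr0_norm //.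
  apply: (le_trans (ler_wpM2l (ltW c0) (hM x))).
  by rewrite /c invfM -mulrA mulVf ?mulr1 // mulf_neq0 ?lt0r_neq0.
have : rnorm (T U s) ^+ 2 <= 2 * (M * M).
  rewrite -cs_cstar -star // -mul // -/V -/h -/E.
  move: TE; rewrite repZ // rnormZR gtr0_norm // /c mulrC ler_pdivrMr ?mulr_gt0 //.
  by rewrite mul1r.
have := rnorm_ge0 (T U s); move: (rnorm _) => r; nra.
Qed.

End Representation.

(** * Finite sums of sections and their images under a representation *)

Section RepSum.
Variables (R : realType) (G : etaleGroupoid) (B : fellBundle R G).
Variables (S : set (set G)) (D : cstarAlgebra R) (T : set G -> section B -> D).
Hypotheses (S_inv : inverse_subsemigroup S) (S_wide : wide S).
Hypothesis T_rep : bundle_rep true S T.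
Implicit Types (U V W : set G) (Us Vs : seq (set G)) (s t p q r : section B) (d e : D).

(** A relation rather than a function, since decompositions over [Us] are not
    unique; that [p] determines [d] follows from [rep_sum_bound]. *)
Fixpoint rep_sum Us p d : Prop :=
  if Us is U :: Us' then exists s q e,
    [/\ asec true U s, rep_sum Us' q e, p = s + q & d = T U s + e]
  else p = 0 /\ d = 0.

Lemma rep_sum0 Us : [set` Us] `<=` S -> rep_sum Us 0 0.
Proof.
elim: Us => [|U Us IH] //= US; exists 0, 0, 0; split; rewrite ?addr0 //.
- exact: asec0.
- by apply: IH => V VU; apply: US; rewrite /= in_cons VU orbT.
- by rewrite (rep0 T_rep) //; apply: US; rewrite /= mem_head.
Qed.

Lemma rep_sum_linear Us k p q d e : [set` Us] `<=` S ->
  rep_sum Us p d -> rep_sum Us q e -> rep_sum Us (k *: p + q) (k *: d + e).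
Proof.
elim: Us p q d e => [|U Us IH] p q d e US /=.
  by move=> [-> ->] [-> ->]; rewrite !scaler0 !addr0.
have SU : S U by apply: US; rewrite /= mem_head.
have USs : [set` Us] `<=` S by move=> V VU; apply: US; rewrite /= in_cons VU orbT.
move=> [s [p' [d' [sU pd -> ->]]]] [t [q' [e' [tU qe -> ->]]]].
exists (k *: s + t), (k *: p' + q'), (k *: d' + e'); split.
- by apply: asecD => //; exact: asecZ.
- exact: IH.
- by rewrite scalerDr addrACA.
- by have [-> // _ _ _] := T_rep; rewrite scalerDr addrACA.
Qed.

Lemma rep_sumD Us p q d e : [set` Us] `<=` S ->
  rep_sum Us p d -> rep_sum Us q e -> rep_sum Us (p + q) (d + e).
Proof. by move=> US pd qe; have := rep_sum_linear 1 US pd qe; rewrite !scale1r. Qed.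

Lemma rep_sum_one Us U s : [set` Us] `<=` S -> U \in Us -> asec true U s ->
  rep_sum Us s (T U s).
Proof.
elim: Us => [|V Us IH] //= US; rewrite in_cons.
have USs : [set` Us] `<=` S by move=> W WU; apply: US; rewrite /= in_cons WU orbT.
case/orP => [/eqP -> sV|/IH H sU].
  by exists s, 0, 0; split; rewrite ?addr0 //; exact: rep_sum0.
exists 0, s, (T U s); split; rewrite ?add0r //; [exact: asec0|exact: H|].
by rewrite (rep0 T_rep) ?add0r //; apply: US; rewrite /= mem_head.
Qed.

Lemma rep_sum_cat Us Vs p q d e : rep_sum Us p d -> rep_sum Vs q e ->
  rep_sum (Us ++ Vs) (p + q) (d + e).
Proof.
elim: Us p d => [|U Us IH] p d /=; first by move=> [-> ->]; rewrite !add0r.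
move=> [s [p' [d' [sU pd -> ->]]]] qe.
by exists s, (p' + q), (d' + e); split; rewrite ?addrA //; exact: IH.
Qed.

Lemma rep_sum_supp Us p d x : rep_sum Us p d -> p x != 0 -> exists2 U, U \in Us & U x.
Proof.
elim: Us p d => [|U Us IH] p d /=; first by move=> [-> _] /eqP.
move=> [s [q [e [[s0 _ _] qe -> _]]]]; change ((s + q) x) with (s x + q x) => n0.
have [Ux|/s0 sx] := pselect (U x); first by exists U; rewrite ?mem_head.
rewrite sx add0r in n0; have [V VU Vx] := IH _ _ qe n0.
by exists V; rewrite // in_cons VU orbT.
Qed.

(** Uniformly small sums have small images; in particular the image depends on
    the sum alone.  Where the first section [s] exceeds [2 e] in norm, another
    one of the sections does not vanish, so that its slice meets that of [s].
    Up to a section of norm at most [2 e], [s] therefore decomposes over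
    members of [S] contained in both slices, which can be attributed to the
    others. *)
Lemma rep_sum_bound Us : [set` Us] `<=` S ->
  exists2 C : R, 0 <= C & forall p d (eps : R), 0 < eps -> rep_sum Us p d ->
    (forall x, rnorm (p x) <= eps) -> rnorm d <= C * eps.
Proof.
elim: Us => [|U Us IH] US.
  by exists 0 => // p d eps e0 [_ ->] _; rewrite rnorm0 mul0r.
have SU : S U by apply: US; rewrite /= mem_head.
have USs : [set` Us] `<=` S by move=> V VU; apply: US; rewrite /= in_cons VU orbT.
have [C C0 CP] := IH USs; exists (4 + C * 3); first by rewrite addr_ge0 ?mulr_ge0.
move=> p d eps e0 [s [q [d' [sU qd pE ->]]]] p_le.
have slU := S_slice S_inv SU; have oU := S_open S_inv SU; have sepU := slice_separated slU.
have [s0 sc _] := sU.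
have pq x : p x = s x + q x by rewrite pE.
pose F W := [/\ S W, W `<=` U & exists2 V, V \in Us & W `<=` V].
pose P r := asec true U r /\ rep_sum Us r (T U r).
pose K := [set x | 2 * eps <= rnorm (s x)].
(* [r] is the part of [s] that is attributed to the other slices; it agrees with
   [s] on [K], and [s - r] has norm at most [2 * eps] everywhere. *)
have [r [[rU rd] rK r_le]] : exists r, [/\ P r, forall x, K x -> r x = s x &
    forall x, rnorm (s x - r x) <= rnorm (s x)].
  apply: (@peel _ _ B U F P K s sepU) => //.
  - by apply: asec_level oU sU _; rewrite mulr_gt0.
  - by move=> W [SW WU _]; split => //; exact: (S_open S_inv).
  - move=> x Kx; have Ux : U x.
      apply: contrapT => /s0 sx; move: Kx; rewrite /K /= sx rnorm0; lra.
    have qx : q x != 0.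
      apply/eqP => q0; have := p_le x; rewrite pq q0 addr0; move: Kx; rewrite /K /=; lra.
    have [V VU Vx] := rep_sum_supp qd qx.
    have [W [SW Wx WUV]] := S_wide.2 U V x SU (USs _ VU) Ux Vx.
    exists W => //; split => //; first by move=> y /WUV[].
    by exists V => // y /WUV[].
  - by split; [exact: asec0|rewrite (rep0 T_rep) //; exact: rep_sum0].
  - move=> r1 r2 [r1U r1d] [r2U r2d]; split; first exact: asecD.
    by rewrite (repD T_rep) //; exact: rep_sumD.
  - move=> W r [SW WU [V VU WV]] rW; have oW := S_open S_inv SW.
    split; first exact: asec_widen rW.
    have [_ _ _ incl] := T_rep.
    rewrite -(incl W U) // (incl W V) //; last exact: USs.
    apply: rep_sum_one => //; apply: asec_widen rW => //.
    exact/slice_separated/(S_slice S_inv)/USs.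
  - by move=> r1 [[_ r1c _] _].
have sr x : rnorm (s x - r x) <= 2 * eps.
  have [/rK ->|/negP] := pselect (K x); first by rewrite subrr rnorm0 mulr_ge0 // ltW.
  by rewrite -ltNge => /ltW; exact: le_trans (r_le x).
have e2 : 0 < 2 * eps by rewrite mulr_gt0.
have srT : rnorm (T U (s - r)) <= 2 * (2 * eps).
  exact: (rep_bound S_inv T_rep SU (asecB sU rU) e2 sr).
have e3 : 0 < 3 * eps by rewrite mulr_gt0.
have rest : rnorm (d' + T U r) <= C * (3 * eps).
  apply: (CP (q + r)) => //; first exact: rep_sumD.
  move=> x; change ((q + r) x) with (q x + r x).
  have -> : q x + r x = p x - (s x - r x).
    by rewrite pq opprB (addrC (s x)) (addrC (r x)) addrA addrK.
  by apply: (le_trans (rnormB _ _)); have := p_le x; have := sr x; lra.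
have -> : T U s + d' = T U (s - r) + (d' + T U r).
  by rewrite (repB T_rep) // (addrC d') addrA subrK.
by apply: (le_trans (rnormD _ _)); lra.
Qed.

(** The graph of the linear map that the family [T] induces on finite sums of
    sections. *)
Definition rep_val p d := exists2 Us, [set` Us] `<=` S & rep_sum Us p d.

Lemma rep_val_linear k p q d e :
  rep_val p d -> rep_val q e -> rep_val (k *: p + q) (k *: d + e).
Proof.
move=> [Us US pd] [Vs VS qe]; exists (Us ++ Vs).
  by move=> U /=; rewrite mem_cat => /orP[/US|/VS].
apply: rep_sum_cat => //.
have := rep_sum_linear k US pd (rep_sum0 US); rewrite !addr0; exact.
Qed.

Lemma rep_val0 : rep_val 0 0.
Proof. by exists [::]. Qed.

Lemma rep_valD p q d e : rep_val p d -> rep_val q e -> rep_val (p + q) (d + e).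
Proof. by move=> pd qe; have := rep_val_linear 1 pd qe; rewrite !scale1r. Qed.

Lemma rep_val_one U s : S U -> asec true U s -> rep_val s (T U s).
Proof.
move=> SU sU; exists [:: U]; first by move=> V /=; rewrite inE => /eqP ->.
by apply: rep_sum_one => //; [move=> V /=; rewrite inE => /eqP ->|rewrite mem_head].
Qed.

Lemma rep_val_fun p d e : rep_val p d -> rep_val p e -> d = e.
Proof.
move=> pd pe; have := rep_val_linear (-1) pe pd; rewrite !scaleN1r !addNr.
move=> [Us US H]; have [C C0 CP] := rep_sum_bound US.
apply/eqP; rewrite -subr_eq0 addrC; apply/eqP; apply: (@rnorm_small_eq0 _ _ _ C) => eps e0.
by apply: CP H _ => // x; rewrite rnorm0 ltW.
Qed.

Lemma rep_val_ind (Q : section B -> D -> Prop) : Q 0 0 ->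
  (forall U s p d, S U -> asec true U s -> rep_val p d -> Q p d ->
     Q (s + p) (T U s + d)) ->
  forall p d, rep_val p d -> Q p d.
Proof.
move=> Q0 Qs p d [Us]; elim: Us p d => [|U Us IH] p d US /=; first by move=> [-> ->].
have USs : [set` Us] `<=` S by move=> V VU; apply: US; rewrite /= in_cons VU orbT.
move=> [s [q [e [sU qe -> ->]]]]; apply: Qs => //.
- by apply: US; rewrite /= mem_head.
- by exists Us.
- exact: IH.
Qed.

Lemma rep_val_fin_fibred p d : rep_val p d -> fin_fibred p.
Proof.
move: p d; apply: rep_val_ind => [y|U s p d SU [s0 _ _] _ pf].
  by rewrite (_ : [set _ | _] = set0) // -subset0 => g [_ /eqP].
by apply: fin_fibredD => //; exact: slice_fin_fibred (S_slice S_inv SU) s0.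
Qed.

Lemma rep_val_mul p q d e : rep_val p d -> rep_val q e ->
  rep_val (conv_on setT p q) (cs_mul D d e).
Proof.
move=> + qe; move: p d; apply: rep_val_ind => [|U s p d SU sU pd IH].
  have := conv_linearl (-1) (s := 0) (s' := 0) q.
  rewrite scaler0 addr0 scaleN1r addNr => ->; first by rewrite cs_mul0l; exact: rep_val0.
    exact: rep_val_fin_fibred rep_val0.
  exact: rep_val_fin_fibred rep_val0.
have sf : fin_fibred s by case: sU => s0 _ _; exact: slice_fin_fibred (S_slice S_inv SU) s0.
rewrite -{1}(scale1r s) conv_linearl //; last exact: rep_val_fin_fibred pd.
rewrite scale1r cs_mulDl; apply: rep_valD => //.
move: q e qe {IH}; apply: rep_val_ind => [|V t q e SV tV qe IH].
  have := conv_linearr (-1) (s := s) 0 0 sf.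
  rewrite scaler0 addr0 scaleN1r addNr => ->; rewrite cs_mul0r; exact: rep_val0.
rewrite -{1}(scale1r t) conv_linearr // scale1r cs_mulDr; apply: rep_valD => //.
have [_ Smul _] := S_inv; have [_ mul _ _] := T_rep.
rewrite -mul //; have [s0 _ _] := sU; have [t0 _ _] := tV.
rewrite -(sec_mul_conv s0 t0); apply: rep_val_one; first exact: Smul.
by apply: asec_mul => //; [exact: (S_slice S_inv)|exact: (S_slice S_inv)|exact/(S_open S_inv)/Smul].
Qed.

Lemma rep_val_star p d : rep_val p d -> rep_val (sec_star p) (cs_star D d).
Proof.
move: p d; apply: rep_val_ind => [|U s p d SU sU pd IH].
  by rewrite sec_star0 cs_star0; exact: rep_val0.
rewrite sec_starD cs_starD; apply: rep_valD => //.
have [_ _ Sinv] := S_inv; have [_ _ star _] := T_rep; rewrite -star //.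
by apply: rep_val_one; [exact: Sinv|apply: asec_star => //; exact: (S_slice S_inv)].
Qed.

(** Since [S] covers the groupoid, sections supported in members of [S] can be
    peeled off over the compact support of [t], and nothing remains. *)
Lemma rep_val_Cc V t : open V -> separated_on V -> asec true V t -> exists d, rep_val t d.
Proof.
move=> oV sV [t0 tc tK]; have [K [cK KV Kt]] := tK 0 (lexx 0).
pose F W := exists2 U, S U & W = U `&` V.
pose P p := (exists d, rep_val p d) /\ forall x, V x -> scont p x.
have oF W : F W -> open W.
  by move=> [U SU ->]; apply: openI => //; exact: (S_open S_inv).
have [p [[[d pd] _] pK p_le]] : exists p, [/\ P p, forall x, K x -> p x = t x &
    forall x, rnorm (t x - p x) <= rnorm (t x)].
  apply: (@peel _ _ B V F P K t sV) => //.
  - by move=> W FW; split; [exact: oF|case: FW => U _ -> x []].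
  - move=> x Kx; have [U SU Ux] := S_wide.1 x.
    by exists (U `&` V); [exists U|split => //; exact: KV].
  - by split; [exists 0; exact: rep_val0|move=> x _; exact: scont0].
  - move=> p q [[d pd] pc] [[e qe] qc]; split; first by exists (d + e); exact: rep_valD.
    by move=> x Vx; apply: scontD; [exact: pc|exact: qc].
  - move=> W p FW pW; have oW := oF W FW; case: FW => U SU WE; split.
      exists (T U p); apply: rep_val_one => //; apply: asec_widen pW => //.
        exact/slice_separated/(S_slice S_inv).
      by rewrite WE => x [].
    by move=> x; apply: asec_cont pW => //; rewrite WE => y [].
  - by move=> p [].
exists d; suff -> : t = p by [].
apply/functional_extensionality_dep => x; have [/pK //|/Kt/rnorm0_eq0 tx] := pselect (K x).
have := p_le x; rewrite tx sub0r rnormN rnorm0 => /rnorm0_eq0 ->.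
by [].
Qed.

End RepSum.

(** * Extension by continuity *)

Section Extension.
Variables (R : realType) (G : etaleGroupoid) (B : fellBundle R G).
Variables (S : set (set G)) (D : cstarAlgebra R).
Hypothesis S_inv : inverse_subsemigroup S.
Implicit Types (U V W : set G) (s t : section B) (e : R).

(** Peel off the compact set where [s] is at least [e] in norm. *)
Lemma asec_dense U s e : slice U -> asec false U s -> 0 < e ->
  exists2 t, asec true U t & forall x, rnorm (s x - t x) <= e.
Proof.
move=> slU sU e0; have [oU _ _] := slU; have [s0 sc _] := sU.
have [t [tU tK t_le]] : exists t, [/\ asec true U t,
    forall x, [set x | e <= rnorm (s x)] x -> t x = s x &
    forall x, rnorm (s x - t x) <= rnorm (s x)].
  apply: (@peel _ _ B U [set U] _ _ s (slice_separated slU)) => //.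
  - exact: asec_level oU sU e0.
  - by move=> W ->; split.
  - move=> x /= ex; exists U => //; apply: contrapT => /s0 sx.
    by move: ex; rewrite sx rnorm0; lra.
  - exact: asec0.
  - by move=> p q; exact: asecD.
  - by move=> W p ->.
  - by move=> p [].
exists t => // x; have [/tK ->|/negP] := pselect (e <= rnorm (s x)).
  by rewrite subrr rnorm0 ltW.
by rewrite -ltNge => /ltW; exact: le_trans (t_le x).
Qed.

Lemma rnorm_small1_eq0 (E : normedModType R[i]) (v : E) (C : R) :
  (forall e, 0 < e -> e <= 1 -> rnorm v <= C * e) -> v = 0.
Proof.
move=> small; have C0 : 0 <= C.
  by have := small 1 ltr01 (lexx 1); rewrite mulr1; apply: le_trans; exact: rnorm_ge0.
apply: (@rnorm_small_eq0 _ _ _ C) => e e0; have [e1|e1] := leP e 1; first exact: small.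
apply: (le_trans (small 1 ltr01 (lexx 1))); rewrite ler_wpM2l // ltW //.
Qed.

Lemma bundle_rep_sub (T : set G -> section B -> D) :
  bundle_rep false S T -> bundle_rep true S T.
Proof.
have sub U s : asec true U s -> asec false U s by exact: asec_sub.
move=> [lin mul star incl]; split.
- by move=> U k s t SU /sub sU /sub tU; exact: lin.
- by move=> U V s t SU SV /sub sU /sub tV; exact: mul.
- by move=> U s SU /sub; exact: star.
- by move=> U V s SU SV UV /sub; exact: incl.
Qed.

Lemma rep_dense_eq (T T' : set G -> section B -> D) :
  bundle_rep false S T -> bundle_rep false S T' ->
  (forall U s, S U -> asec true U s -> T U s = T' U s) ->
  forall U s, S U -> asec false U s -> T U s = T' U s.
Proof.
move=> rT rT' TT' U s SU sU; apply/eqP; rewrite -subr_eq0; apply/eqP.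
apply: (@rnorm_small_eq0 _ _ _ 4) => e e0.
have [t tU st] := asec_dense (S_slice S_inv SU) sU e0.
have tU' := asec_sub false tU.
have -> : T U s - T' U s = T U (s - t) - T' U (s - t).
  by rewrite (repB rT) // (repB rT') // -(TT' U t) // opprB addrA subrK.
apply: (le_trans (rnormB _ _)).
have := rep_bound S_inv rT SU (asecB sU tU') e0 st.
have := rep_bound S_inv rT' SU (asecB sU tU') e0 st.
lra.
Qed.

Section Extend.
Variable T : set G -> section B -> D.
Hypothesis T_rep : bundle_rep true S T.

(** The value at [s] of the extension of [T U] by continuity; the factor 2 is the
    constant of [rep_bound]. *)
Definition ext_val U s d := forall t e, 0 < e -> asec true U t ->
  (forall x, rnorm (s x - t x) <= e) -> rnorm (d - T U t) <= 2 * e.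

Lemma ext_val_ex U s : S U -> asec false U s -> exists d, ext_val U s d.
Proof.
move=> SU sU; have slU := S_slice S_inv SU.
pose a n : R := (2^-1) ^+ n.
have a0 n : 0 < a n by rewrite exprn_gt0 // invr_gt0.
have a_le n m : (n <= m)%N -> a m <= a n.
  by move=> nm; rewrite ler_wiXn2l //; lra.
have /(fun H n => cid2 (H n)) tn : forall n, exists2 t, asec true U t &
    forall x, rnorm (s x - t x) <= a n.
  by move=> n; exact: asec_dense.
pose u n := T U (s2val (tn n)).
have tU n : asec true U (s2val (tn n)) by case: (tn n).
have tle n x : rnorm (s x - s2val (tn n) x) <= a n by case: (tn n) x.
have uC n m : (n <= m)%N -> rnorm (u m - u n) <= 4 * a n.
  move=> nm; rewrite /u -(repB T_rep) //.
  have -> : 4 * a n = 2 * (2 * a n) by ring.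
  apply: (rep_bound S_inv T_rep SU) => //; first exact: asecB.
    by rewrite mulr_gt0.
  move=> x; change (rnorm (s2val (tn m) x - s2val (tn n) x) <= 2 * a n).
  apply: (le_trans (rnorm_dist _ (s x) _)); rewrite rnorm_distC.
  by have := tle m x; have := tle n x; have := a_le _ _ nm; lra.
have b0 e : 0 < e -> exists N, 4 * a N <= e.
  move=> e0; have [N Ne] := geometric_small (divr_gt0 e0 (ltr0Sn R 1)).
  by exists N; rewrite /a; lra.
have [d du] := rnorm_complete b0 uC.
exists d => t e e0 tU' st; apply/ler_addgt0Pr => e' e'0.
have [N Ne] := b0 (e' / 2) (divr_gt0 e'0 (ltr0Sn R 1)).
apply: (le_trans (rnorm_dist _ (u N) _)).
have := du N; have := a0 N.
have : rnorm (u N - T U t) <= 2 * (e + a N); last lra.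
rewrite /u -(repB T_rep) //; apply: (rep_bound S_inv T_rep SU) => //.
- exact: asecB.
- by rewrite addr_gt0.
move=> x; change (rnorm (s2val (tn N) x - t x) <= e + a N).
apply: (le_trans (rnorm_dist _ (s x) _)); rewrite rnorm_distC.
by have := tle N x; have := st x; lra.
Qed.

(** Each identity is obtained from that for compactly supported sections by
    approximating all sections involved within [e]. *)
Lemma rep_extend : exists2 T', bundle_rep false S T' &
  forall U s, S U -> asec true U s -> T' U s = T U s.
Proof.
pose T' U s := xget 0 [set d | ext_val U s d].
have T'P U s : S U -> asec false U s -> ext_val U s (T' U s).
  by move=> SU /(ext_val_ex SU)[d dP]; rewrite /T'; case: xgetP => [y _ //|/(_ d)].
have dense U s e (SU : S U) := @asec_dense U s e (S_slice S_inv SU).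
have [lin mul star incl] := T_rep; have [_ Smul Sinv] := S_inv.
exists T'; last first.
  move=> U s SU sU; apply/eqP; rewrite -subr_eq0; apply/eqP.
  apply: (@rnorm_small_eq0 _ _ _ 2) => e e0.
  by apply: T'P => // [|x]; [exact: asec_sub|rewrite subrr rnorm0 ltW].
split.
- move=> U k s t SU sU tU; apply/eqP; rewrite -subr_eq0; apply/eqP.
  set K := complex.Re `|k|; have K0 : 0 <= K by rewrite /K normc_def /= sqrtr_ge0.
  apply: (@rnorm_small_eq0 _ _ _ (4 * (K + 1))) => e e0.
  have [s' sU' ss'] := dense U s e SU sU e0; have [t' tU' tt'] := dense U t e SU tU e0.
  have stU : asec true U (k *: s' + t') by apply: asecD => //; exact: asecZ.
  have e1 : 0 < (K + 1) * e by rewrite mulr_gt0 // ltr_wpDl.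
  have H x : rnorm ((k *: s + t) x - (k *: s' + t') x) <= (K + 1) * e.
    change (rnorm (k *: s x + t x - (k *: s' x + t' x)) <= (K + 1) * e).
    rewrite opprD addrACA -scalerBr; apply: (le_trans (rnormD _ _)).
    by rewrite rnormZ -/K mulrDl mul1r lerD // ler_wpM2l.
  have := T'P U _ SU (asecD (asecZ k sU) tU) _ _ e1 stU H; rewrite lin //.
  set A := T' U _ => HA.
  have HS := T'P U s SU sU _ _ e0 sU' ss'; have HT := T'P U t SU tU _ _ e0 tU' tt'.
  have -> : A - (k *: T' U s + T' U t) = (A - (k *: T U s' + T U t')) -
      (k *: (T' U s - T U s') + (T' U t - T U t')).
    by rewrite scalerBr addrACA -opprD opprB addrA subrK.
  apply: (le_trans (rnormB _ _)).
  have : rnorm (k *: (T' U s - T U s') + (T' U t - T U t')) <= K * (2 * e) + 2 * e.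
    by apply: (le_trans (rnormD _ _)); rewrite lerD // rnormZ -/K ler_wpM2l.
  lra.
- move=> U V s t SU SV sU tV; apply/eqP; rewrite -subr_eq0; apply/eqP.
  have slU := S_slice S_inv SU; have slV := S_slice S_inv SV.
  have oU := S_open S_inv SU; have oV := S_open S_inv SV.
  have SUV := Smul _ _ SU SV; have oUV := S_open S_inv SUV.
  have [M M0 sM] := asec_bounded oU sU; have [N N0 tN] := asec_bounded oV tV.
  set P := rnorm (T' U s); set Q := rnorm (T' V t).
  apply: (@rnorm_small1_eq0 _ _ (2 * (N + (M + 1)) + (2 * Q + (P + 2) * 2))) => e e0 e1.
  have [s' sU' ss'] := dense U s e SU sU e0; have [t' tV' tt'] := dense V t e SV tV e0.
  have s'M x : rnorm (s' x) <= M + 1.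
    rewrite -[s' x](subrK (s x)); apply: (le_trans (rnormD _ _)); rewrite rnorm_distC.
    by have := ss' x; have := sM x; lra.
  have stU : asec true (bmul U V) (sec_mul U V s' t') by exact: asec_mul.
  have eNM : 0 < (N + (M + 1)) * e by rewrite mulr_gt0 // !addr_gt0.
  have [s0 _ _] := sU; have [t0 _ _] := tV; have [s0' _ _] := sU'; have [t0' _ _] := tV'.
  have ssU := asecB sU (asec_sub false sU'); have ttV := asecB tV (asec_sub false tV').
  have H x : rnorm (sec_mul U V s t x - sec_mul U V s' t' x) <= (N + (M + 1)) * e.
    have -> : sec_mul U V s t x - sec_mul U V s' t' x =
        sec_mul U V (s - s') t x + sec_mul U V s' (t - t') x.
      have [ss0 _ _] := ssU; have [tt0 _ _] := ttV.
      rewrite !sec_mul_conv //.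
      have ff u : (forall x, ~ U x -> u x = 0) -> fin_fibred u by exact: slice_fin_fibred.
      rewrite (addrC s) (addrC t) -(scaleN1r s') -(scaleN1r t').
      rewrite conv_linearl ?conv_linearr //; [|exact: ff|exact: ff|exact: ff].
      rewrite !scaleN1r.
      set a := conv_on _ s t; set c := conv_on _ s' t; set d := conv_on _ s' t'.
      change (a x - d x = (- c x + a x) + (- d x + c x)).
      by rewrite [RHS]addrC addrA addrK addrC.
    apply: (le_trans (rnormD _ _)); rewrite mulrDl lerD //.
      rewrite mulrC; apply: sec_mul_le => //; exact: ltW.
    apply: sec_mul_le => //; last exact: ltW.
    by rewrite addr_ge0 // ltW.
  have := T'P _ _ SUV (asec_mul slU slV oUV sU tV) _ _ eNM stU H; rewrite mul //.
  set A := T' _ _ => HA.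
  have HS := T'P U s SU sU _ _ e0 sU' ss'; have HT := T'P V t SV tV _ _ e0 tV' tt'.
  have -> : A - cs_mul D (T' U s) (T' V t) = (A - cs_mul D (T U s') (T V t')) -
      (cs_mul D (T' U s - T U s') (T' V t) + cs_mul D (T U s') (T' V t - T V t')).
    have -> : cs_mul D (T' U s - T U s') (T' V t) + cs_mul D (T U s') (T' V t - T V t') =
        cs_mul D (T' U s) (T' V t) - cs_mul D (T U s') (T V t').
      by rewrite cs_mulBl cs_mulBr addrA subrK.
    by rewrite opprB addrA subrK.
  apply: (le_trans (rnormB _ _)).
  have TP : rnorm (T U s') <= P + 2.
    rewrite -[T U s'](subrK (T' U s)); apply: (le_trans (rnormD _ _)).
    by rewrite rnorm_distC -/P; lra.
  have m1 : rnorm (cs_mul D (T' U s - T U s') (T' V t)) <= 2 * e * Q.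
    by apply: (le_trans (cs_mul_norm _ _)); rewrite ler_wpM2r ?rnorm_ge0.
  have m2 : rnorm (cs_mul D (T U s') (T' V t - T V t')) <= (P + 2) * (2 * e).
    by apply: (le_trans (cs_mul_norm _ _)); rewrite ler_pM ?rnorm_ge0.
  have := rnormD (cs_mul D (T' U s - T U s') (T' V t))
    (cs_mul D (T U s') (T' V t - T V t')).
  lra.
- move=> U s SU sU; apply/eqP; rewrite -subr_eq0; apply/eqP.
  have slU := S_slice S_inv SU.
  apply: (@rnorm_small_eq0 _ _ _ 4) => e e0.
  have [t tU st] := dense U s e SU sU e0.
  have := T'P _ _ (Sinv _ SU) (asec_star slU sU) _ _ e0 (asec_star slU tU).
  rewrite star // => H.
  have HS := T'P U s SU sU _ _ e0 tU st.
  have -> : T' (binv U) (sec_star s) - cs_star D (T' U s) =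
      (T' (binv U) (sec_star s) - cs_star D (T U t)) - cs_star D (T' U s - T U t).
    by rewrite cs_starB opprB addrA subrK.
  apply: (le_trans (rnormB _ _)); rewrite cs_star_norm.
  have : rnorm (T' (binv U) (sec_star s) - cs_star D (T U t)) <= 2 * e; last lra.
  apply: H => x.
  have -> : sec_star s x - sec_star t x = sec_star (s - t) x.
    by rewrite -(scaleN1r t) sec_starD sec_starZ rmorphN1 scaleN1r.
  rewrite sec_star_norm; exact: st.
- move=> U V s SU SV UV sU; apply/eqP; rewrite -subr_eq0; apply/eqP.
  have oU := S_open S_inv SU; have sV := slice_separated (S_slice S_inv SV).
  apply: (@rnorm_small_eq0 _ _ _ 4) => e e0.
  have [t tU st] := dense U s e SU sU e0.
  have HU := T'P U s SU sU _ _ e0 tU st.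
  have := T'P V s SV (asec_widen oU sV UV sU) _ _ e0 (asec_widen oU sV UV tU) st.
  rewrite -(incl U V) // => HV.
  apply: (le_trans (rnorm_dist _ (T U t) _)); rewrite (rnorm_distC (T U t)); lra.
Qed.

End Extend.

End Extension.

(** * Formal sums *)

Section FormalSums.
Variables (R : realType) (G : etaleGroupoid) (B : fellBundle R G).
Variables (S : set (set G)).
Hypothesis S_inv : inverse_subsemigroup S.
Local Notation formal := (set G -> section B).
Implicit Types (U V W : set G) (s t : section B) (f g : formal).

Lemma deltaE U s : delta U s U = s.
Proof. by rewrite /delta eqxx. Qed.

Lemma delta_neq U V s : V != U -> delta U s V = 0.
Proof. by rewrite /delta => /negPf ->. Qed.

Lemma delta_linear U (k : R[i]) s t :
  delta U (k *: s + t) = k *: delta U s + delta U t :> formal.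
Proof.
apply/funext => V; change (delta U (k *: s + t) V = k *: delta U s V + delta U t V).
by rewrite /delta; case: ifP => _ //; rewrite scaler0 addr0.
Qed.

Lemma CcA_P f : CcA B S f <-> [/\ finite_set [set U | f U != 0],
  forall U, S U -> asec false U (f U) & forall U, ~ S U -> f U = 0].
Proof.
by split=> -[fin fS f0]; split => // U SU; have := fS U SU; rewrite C0secE //;
  exact: (S_open S_inv).
Qed.

Lemma CcA0_P f : CcA0 B S f <-> [/\ finite_set [set U | f U != 0],
  forall U, S U -> asec true U (f U) & forall U, ~ S U -> f U = 0].
Proof.
by split=> -[fin fS f0]; split => // U SU; have := fS U SU; rewrite CcsecE //;
  exact: (S_open S_inv).
Qed.

Lemma CcA0_CcA f : CcA0 B S f -> CcA B S f.
Proof.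
by move=> /CcA0_P[fin fS f0]; apply/CcA_P; split => // U /fS; exact: asec_sub.
Qed.

Lemma CcA_delta U s : S U -> asec false U s -> CcA B S (delta U s).
Proof.
move=> SU sU; apply/CcA_P; split.
- apply: (@sub_finite_set _ _ [set U]); last exact: finite_set1.
  by move=> V /=; apply: contraNP => /eqP/delta_neq ->.
- move=> V SV; rewrite /delta; case: eqVneq => [->//|_]; exact: asec0.
- by move=> V nSV; apply: delta_neq; apply/eqP => VU; rewrite VU in nSV.
Qed.

Lemma CcA_linear (k : R[i]) f g : CcA B S f -> CcA B S g -> CcA B S (k *: f + g).
Proof.
move=> /CcA_P[finf fS f0] /CcA_P[fing gS g0]; apply/CcA_P; split.
- apply: (@sub_finite_set _ _ ([set U | f U != 0] `|` [set U | g U != 0])).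
    move=> U /=; change ((k *: f + g) U) with (k *: f U + g U).
    by have [->|] := eqVneq (f U) 0; [rewrite scaler0 add0r; right|left].
  by rewrite finite_setU.
- move=> U SU; change ((k *: f + g) U) with (k *: f U + g U).
  by apply: asecD; [apply: asecZ; exact: fS|exact: gS].
- move=> U nSU; change ((k *: f + g) U) with (k *: f U + g U).
  by rewrite f0 // g0 // scaler0 addr0.
Qed.

Lemma CcA0sum : CcA B S 0.
Proof.
apply/CcA_P; split => // [|U _]; last exact: asec0.
by rewrite (_ : [set _ | _] = set0) // -subset0 => U /= /eqP.
Qed.

Lemma formal_suppP f : finite_set [set U | f U != 0] -> (forall U, ~ S U -> f U = 0) ->
  exists r : seq (set G), [/\ uniq r, [set` r] `<=` S & forall U, U \notin r -> f U = 0].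
Proof.
move=> /finite_seqP[r rE] f0.
have mE U : (U \in r) = (f U != 0).
  have E : is_true (f U != 0) = is_true (U \in r) := congr1 (fun A => A U) rE.
  by apply/idP/idP; rewrite E.
exists (undup r); split; [exact: undup_uniq| |].
- by move=> U /=; rewrite mem_undup mE; apply: contraNP => /f0 ->.
- by move=> U; rewrite mem_undup mE negbK => /eqP.
Qed.

Lemma sum_applyE (I : Type) (r : seq I) (F : I -> formal) W :
  (\sum_(i <- r) F i) W = \sum_(i <- r) F i W.
Proof. by elim: r => [|U r IH]; rewrite ?big_nil // !big_cons -IH. Qed.

Lemma formal_decomp f (r : seq (set G)) : uniq r -> (forall U, U \notin r -> f U = 0) ->
  f = \sum_(U <- r) delta U (f U).
Proof.
move=> ur f0; apply/funext => W.
rewrite sum_applyE.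
have [Wr|Wr] := boolP (W \in r).
  rewrite (bigD1_seq W) //= deltaE big1 ?addr0 // => U UW.
  by rewrite delta_neq // eq_sym.
rewrite f0 // big_seq big1 // => U Ur; rewrite delta_neq //.
by apply: contraNneq Wr => ->.
Qed.

Lemma sec_mul0l U V t : sec_mul U V 0 t = 0.
Proof.
apply/functional_extensionality_dep => x; apply: fsbig1 => g [_ cg _].
by rewrite fmul0l // fiber_at_inc0.
Qed.

Lemma sec_mul0r U V s : sec_mul U V s 0 = 0.
Proof.
apply/functional_extensionality_dep => x; apply: fsbig1 => g [_ cg _].
by rewrite fmul0r // fiber_at_inc0.
Qed.

(** Lists containing the supports turn the sums over the fibres of [bmul] into a
    finite double sum. *)
Lemma formal_mulE f g (r q : seq (set G)) : uniq r -> uniq q ->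
  (forall U, U \notin r -> f U = 0) -> (forall V, V \notin q -> g V = 0) ->
  formal_mul f g =
  \sum_(U <- r) \sum_(V <- q) delta (bmul U V) (sec_mul U V (f U) (g V)).
Proof.
move=> ur uq f0 g0; apply/funext => W; rewrite sum_applyE.
under eq_bigr do rewrite sum_applyE.
set rq := [seq (U, V) | U <- r, V <- q].
pose F UV := delta (bmul UV.1 UV.2) (sec_mul UV.1 UV.2 (f UV.1) (g UV.2)) W.
have -> : \sum_(U <- r) \sum_(V <- q) delta (bmul U V) (sec_mul U V (f U) (g V)) W =
    \sum_(UV <- rq) F UV by rewrite big_allpairs_dep.
have urq : uniq rq by apply: allpairs_uniq => // -[a b] [c d].
rewrite /formal_mul (fsbigE [seq UV <- rq | bmul UV.1 UV.2 == W]).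
- rewrite big_filter_cond big_mkcond; apply: eq_bigr => UV _.
  rewrite /F /delta (eq_sym W); case: eqP => //= E.
  by rewrite mem_set.
- exact: filter_uniq.
- by move=> UV /=; rewrite mem_filter => /andP[/eqP].
- move=> [U V] /= E; rewrite mem_filter /= E eqxx /=.
  have [Ur|/f0 ->] := boolP (U \in r); last by rewrite sec_mul0l.
  have [Vq|/g0 ->] := boolP (V \in q); last by rewrite sec_mul0r.
  by rewrite allpairs_f.
Qed.

Lemma formal_starE f (r : seq (set G)) : uniq r -> (forall U, U \notin r -> f U = 0) ->
  formal_star f = \sum_(U <- r) delta (binv U) (sec_star (f U)).
Proof.
have binvK W : binv (binv W) = W by rewrite !binvE; apply/seteqP; split=> x /=; rewrite ginvK.
move=> ur f0; apply/funext => W; rewrite sum_applyE /formal_star.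
have [Wr|Wr] := boolP (binv W \in r).
  rewrite (bigD1_seq (binv W)) //= binvK deltaE big1 ?addr0 // => U UW.
  by rewrite delta_neq //; apply: contraNneq UW => ->; rewrite binvK.
rewrite (f0 _ Wr) sec_star0 big_seq big1 // => U Ur; rewrite delta_neq //.
by apply: contraNneq Wr => ->; rewrite binvK.
Qed.

(** ** Representations and *-homomorphisms *)

Variable D : cstarAlgebra R.

Lemma cs_mul_sumsum (I J : Type) (r : seq I) (q : seq J) (F : I -> D) (H : J -> D) :
  cs_mul D (\sum_(i <- r) F i) (\sum_(j <- q) H j) =
  \sum_(i <- r) \sum_(j <- q) cs_mul D (F i) (H j).
Proof.
elim: r => [|i r IH]; first by rewrite !big_nil cs_mul0l.
rewrite !big_cons cs_mulDl IH; congr (_ + _).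
elim: q {IH} => [|j q IH]; first by rewrite !big_nil cs_mul0r.
by rewrite !big_cons cs_mulDr IH.
Qed.

(** Compatibility with inclusions is what vanishing on [idealA] says. *)
Lemma star_hom_rep (phi : sq_car (CcA_mod_I B S) -> D) : star_hom phi ->
  bundle_rep false S (fun U s => phi (delta U s)).
Proof.
move=> [lin mul star null]; have [_ Smul Sinv] := S_inv; split.
- by move=> U k s t SU sU tU; rewrite delta_linear lin //; exact: CcA_delta.
- move=> U V s t SU SV sU tV; rewrite -mul; try exact: CcA_delta.
  congr phi; rewrite /= (@formal_mulE _ _ [:: U] [:: V]) //.
  + by rewrite !big_seq1 !deltaE.
  + by move=> W; rewrite inE => /delta_neq.
  + by move=> W; rewrite inE => /delta_neq.
- move=> U s SU sU; rewrite -star; last exact: CcA_delta.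
  congr phi; rewrite /= (@formal_starE _ [:: U]) //; first by rewrite big_seq1 deltaE.
  by move=> W; rewrite inE => /delta_neq.
- move=> U V s SU SV UV sU; apply/eqP; rewrite -subr_eq0; apply/eqP.
  have oU := S_open S_inv SU; have sV := slice_separated (S_slice S_inv SV).
  have : phi (- delta V s + delta U s) = 0.
    apply: null; exists 1%N, (fun=> 1), (fun=> delta U s - delta V s); split.
      by move=> _; exists U, V, s; split => //; rewrite C0secE.
    by rewrite big_ord1 scale1r addrC.
  rewrite -scaleN1r lin ?scaleN1r 1?addrC //; last exact: CcA_delta.
  by apply: CcA_delta => //; exact: asec_widen sU.
Qed.

Section FormalRep.
Variable T : set G -> section B -> D.
Hypothesis T_rep : bundle_rep false S T.

(** The sum is restricted to [S] since [T U 0] need not vanish for other [U]. *)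
Definition formal_rep (f : formal) : D := \sum_(U \in S) T U (f U).

Lemma formal_repE f (r : seq (set G)) : uniq r -> [set` r] `<=` S ->
  (forall U, U \notin r -> f U = 0) -> formal_rep f = \sum_(U <- r) T U (f U).
Proof.
move=> ur rS f0; rewrite /formal_rep (fsbigE r) //; last first.
  by move=> U SU /f0 ->; exact: (rep0 T_rep).
rewrite big_mkcond big_seq [RHS]big_seq; apply: eq_bigr => U Ur.
by rewrite mem_set //; exact: rS.
Qed.

Lemma formal_rep_linear (k : R[i]) f g : CcA B S f -> CcA B S g ->
  formal_rep (k *: f + g) = k *: formal_rep f + formal_rep g.
Proof.
move=> /CcA_P[ff fS f0] /CcA_P[fg gS g0].
have [r [ur rS rf]] := formal_suppP ff f0; have [q [uq qS qg]] := formal_suppP fg g0.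
pose w := undup (r ++ q).
have uw : uniq w by exact: undup_uniq.
have wS : [set` w] `<=` S.
  by move=> U /=; rewrite mem_undup mem_cat => /orP[/rS|/qS].
have wf U : U \notin w -> f U = 0.
  by rewrite mem_undup mem_cat negb_or => /andP[/rf].
have wg U : U \notin w -> g U = 0.
  by rewrite mem_undup mem_cat negb_or => /andP[_ /qg].
rewrite !(formal_repE (r := w)) //; last first.
  move=> U Uw; change (k *: f U + g U = 0).
  by rewrite (wf _ Uw) (wg _ Uw) scaler0 addr0.
rewrite scaler_sumr -big_split /= big_seq [RHS]big_seq; apply: eq_bigr => U /wS SU.
have [lin _ _ _] := T_rep; change ((k *: f + g) U) with (k *: f U + g U).
by rewrite lin //; [exact: fS|exact: gS].
Qed.

Lemma formal_rep_delta U s : S U -> formal_rep (delta U s) = T U s.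
Proof.
move=> SU; rewrite (@formal_repE _ [:: U]) //; first by rewrite big_seq1 deltaE.
  by move=> V /=; rewrite inE => /eqP ->.
by move=> V; rewrite inE => /delta_neq.
Qed.

Lemma formal_rep0 : formal_rep 0 = 0.
Proof. by rewrite (@formal_repE _ [::]) // big_nil. Qed.

Lemma formal_rep_sum (I : eqType) (r : seq I) (F : I -> formal) :
  (forall i, i \in r -> CcA B S (F i)) ->
  formal_rep (\sum_(i <- r) F i) = \sum_(i <- r) formal_rep (F i).
Proof.
move=> FC; suff [] : CcA B S (\sum_(i <- r) F i) /\
  formal_rep (\sum_(i <- r) F i) = \sum_(i <- r) formal_rep (F i) by [].
elim: r FC => [|i r IH] FC.
  by rewrite !big_nil formal_rep0; split => //; exact: CcA0sum.
have [|rC rE] := IH; first by move=> j jr; apply: FC; rewrite in_cons jr orbT.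
have iC : CcA B S (F i) by apply: FC; rewrite mem_head.
rewrite !big_cons; split; first by rewrite -[F i]scale1r; exact: CcA_linear.
by have := formal_rep_linear 1 iC rC; rewrite !scale1r rE.
Qed.

Lemma formal_rep_hom : star_hom (formal_rep : sq_car (CcA_mod_I B S) -> D).
Proof.
have [lin mul star incl] := T_rep; have [_ Smul Sinv] := S_inv.
split => /=; first exact: formal_rep_linear.
- move=> f g /CcA_P[ff fS f0] /CcA_P[fg gS g0].
  have [r [ur rS rf]] := formal_suppP ff f0; have [q [uq qS qg]] := formal_suppP fg g0.
  rewrite (formal_mulE ur uq rf qg) (formal_repE ur rS rf) (formal_repE uq qS qg).
  have mC U V : U \in r -> V \in q ->
      CcA B S (delta (bmul U V) (sec_mul U V (f U) (g V))).
    move=> /rS SU /qS SV; apply: CcA_delta; first exact: Smul.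
    by apply: asec_mul; [exact: (S_slice S_inv)|exact: (S_slice S_inv)|
      exact/(S_open S_inv)/Smul|exact: fS|exact: gS].
  rewrite cs_mul_sumsum formal_rep_sum; last first.
    move=> U Ur; rewrite big_seq; elim/big_ind: _ => [||V Vq]; [exact: CcA0sum| |exact: mC].
    by move=> x y xC yC; rewrite -[x]scale1r; exact: CcA_linear.
  rewrite big_seq [RHS]big_seq; apply: eq_bigr => U Ur.
  rewrite formal_rep_sum; last by move=> V; exact: mC.
  rewrite big_seq [RHS]big_seq; apply: eq_bigr => V Vq.
  have SU := rS _ Ur; have SV := qS _ Vq.
  by rewrite formal_rep_delta ?mul //; [exact: fS|exact: gS|exact: Smul].
- move=> f /CcA_P[ff fS f0]; have [r [ur rS rf]] := formal_suppP ff f0.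
  rewrite (formal_starE ur rf) (formal_repE ur rS rf) formal_rep_sum; last first.
    move=> U /rS SU; apply: CcA_delta; first exact: Sinv.
    by apply: asec_star; [exact: (S_slice S_inv)|exact: fS].
  have -> : cs_star D (\sum_(U <- r) T U (f U)) = \sum_(U <- r) cs_star D (T U (f U)).
    by elim: (r) => [|U r' IH]; rewrite ?big_nil ?cs_star0 // !big_cons cs_starD IH.
  rewrite big_seq [RHS]big_seq; apply: eq_bigr => U /rS SU.
  by rewrite formal_rep_delta ?star //; [exact: fS|exact: Sinv].
- move=> f [n [c [w [wP ->]]]].
  have wC i : CcA B S (w i) /\ formal_rep (w i) = 0.
    have [U [V [s [SU SV UV]]]] := wP i.
    rewrite C0secE; last exact: (S_open S_inv).
    move=> sU ->; have oU := S_open S_inv SU; have sV := slice_separated (S_slice S_inv SV).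
    have UC := CcA_delta SU sU; have VC := CcA_delta SV (asec_widen oU sV UV sU).
    rewrite addrC -scaleN1r; split; first exact: CcA_linear.
    rewrite formal_rep_linear // !formal_rep_delta // (incl U V) // scaleN1r addNr //.
  have cC i : CcA B S (c i *: w i).
    by rewrite -[_ *: _]addr0; apply: CcA_linear; [exact: (wC i).1|exact: CcA0sum].
  rewrite formal_rep_sum //; apply: big1 => i _.
  rewrite -[_ *: _]addr0 formal_rep_linear ?(wC i).2 ?scaler0 ?formal_rep0 ?addr0 //.
    exact: (wC i).1.
  exact: CcA0sum.
Qed.

End FormalRep.

Lemma star_hom_formal_rep (phi : sq_car (CcA_mod_I B S) -> D) f : star_hom phi ->
  CcA B S f -> phi f = formal_rep (fun U s => phi (delta U s)) f.
Proof.
move=> phiP fC; have /CcA_P[ff fS f0] := fC; have [r [ur rS rf]] := formal_suppP ff f0.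
rewrite (formal_repE (star_hom_rep phiP) ur rS rf) {1}(formal_decomp ur rf).
have [lin _ _ _] := phiP.
suff [] : CcA B S (\sum_(U <- r) delta U (f U)) /\
  phi (\sum_(U <- r) delta U (f U)) = \sum_(U <- r) phi (delta U (f U)) by [].
elim: r {ur rf} rS => [|U r IH] rS.
  rewrite !big_nil; split; first exact: CcA0sum.
  by have := lin (-1) 0 0 CcA0sum CcA0sum; rewrite scaler0 addr0 scaleN1r addNr.
have [|rC rE] := IH; first by move=> V Vr; apply: rS; rewrite /= in_cons Vr orbT.
have SU : S U by apply: rS; rewrite /= mem_head.
have UC : CcA B S (delta U (f U)) by apply: CcA_delta => //; exact: fS.
rewrite !big_cons; split; first by rewrite -[delta U _]scale1r; exact: CcA_linear.
by have := lin 1 _ _ UC rC; rewrite !scale1r rE.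
Qed.

End FormalSums.

(** * The isomorphism *)

Section Isomorphism.
Variables (R : realType) (G : etaleGroupoid) (B : fellBundle R G).
Variables (S : set (set G)).
Hypotheses (S_inv : inverse_subsemigroup S) (S_wide : wide S).
Implicit Types (U V : set G) (s t p : section B).

Lemma CcB_slice U s : S U -> asec true U s -> CcB B s.
Proof.
move=> SU sU; exists 1%N, (fun=> U), (fun=> s); split; last by rewrite big_ord1.
move=> _; have slU := S_slice S_inv SU; have [oU _ _] := slU.
split => //; last by rewrite CcsecE.
exact/separated_hausdorff/slice_separated.
Qed.

(** Lists instead of families indexed by ordinals, so that sums become
    concatenations. *)
Lemma CcBP p : CcB B p <-> exists2 r : seq (set G * section B),
  (forall Ut, Ut \in r -> [/\ open Ut.1, hausdorff_space (set_type Ut.1) &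
    Ccsec Ut.1 Ut.2]) & p = \sum_(Ut <- r) Ut.2.
Proof.
split=> [[n [U [t [Ut ->]]]]|[r rP ->]].
  exists [seq (U i, t i) | i <- enum 'I_n]; last by rewrite big_map big_enum.
  by move=> _ /mapP[i _ ->]; exact: Ut.
exists (size r), (fun i => (nth (set0, 0) r i).1), (fun i => (nth (set0, 0) r i).2).
split; first by move=> i; apply: rP; exact: mem_nth.
by rewrite (big_nth (set0, 0)) big_mkord.
Qed.

Lemma CcB0 : CcB B 0.
Proof. by apply/CcBP; exists [::]; rewrite ?big_nil. Qed.

Lemma CcBD p q : CcB B p -> CcB B q -> CcB B (p + q).
Proof.
move=> /CcBP[r rP ->] /CcBP[r' rP' ->]; apply/CcBP; exists (r ++ r').
  by move=> Ut; rewrite mem_cat => /orP[/rP|/rP'].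
by rewrite big_cat.
Qed.

Lemma CcB_bundle_rep (D : cstarAlgebra R) (phi : sq_car (CcB_alg B) -> D) :
  star_hom phi -> bundle_rep true S (fun _ => phi).
Proof.
move=> [lin mul star _]; split => //.
- by move=> U k s t SU sU tU; apply: lin; exact: CcB_slice SU _.
- move=> U V s t SU SV sU tV; have [s0 _ _] := sU; have [t0 _ _] := tV.
  rewrite (sec_mul_conv s0 t0).
  by apply: mul; [exact: CcB_slice SU _|exact: CcB_slice SV _].
- by move=> U s SU sU; apply: star; exact: CcB_slice SU _.
Qed.

Section RepVal.
Variables (D : cstarAlgebra R) (T : set G -> section B -> D).
Hypothesis T_rep : bundle_rep true S T.

Lemma rep_val_CcB p : CcB B p -> exists d, rep_val S T p d.
Proof.
move=> [n [V [t [VP ->]]]]; elim/big_ind: _ => [||i _].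
- by exists 0; exact: rep_val0.
- by move=> q r [d qd] [e re]; exists (d + e); exact: rep_valD.
- have [oV hV] := VP i; rewrite CcsecE // => tV.
  exact: (rep_val_Cc S_inv S_wide T_rep oV (hausdorff_separated oV hV) tV).
Qed.

(** The map on [CcB] whose graph is [rep_val]; well defined by
    [rep_val_fun]. *)
Definition rep_fun p : D := xget 0 [set d | rep_val S T p d].

Lemma rep_funP p d : rep_val S T p d -> rep_fun p = d.
Proof.
move=> pd; rewrite /rep_fun; case: xgetP => [e _ pe|/(_ d) //].
exact: (rep_val_fun S_inv S_wide T_rep pe pd).
Qed.

Lemma rep_fun_hom : star_hom (rep_fun : sq_car (CcB_alg B) -> D).
Proof.
split => /=.
- move=> k p q /rep_val_CcB[d pd] /rep_val_CcB[e qe].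
  rewrite (rep_funP (d := d) pd) (rep_funP (d := e) qe); apply: rep_funP; exact: rep_val_linear.
- move=> p q /rep_val_CcB[d pd] /rep_val_CcB[e qe].
  rewrite (rep_funP (d := d) pd) (rep_funP (d := e) qe); apply: rep_funP; exact: rep_val_mul.
- move=> p /rep_val_CcB[d pd].
  rewrite (rep_funP (d := d) pd); apply: rep_funP; exact: rep_val_star.
- by move=> _ ->; apply: rep_funP; exact: rep_val0.
Qed.

End RepVal.

Lemma PsiE (f : set G -> section B) (r : seq (set G)) : uniq r ->
  (forall U, U \notin r -> f U = 0) -> Psi f = \sum_(U <- r) f U.
Proof.
move=> ur f0; rewrite /Psi (fsbigE r) //; last by move=> U _ /f0.
by rewrite big_mkcond; apply: eq_bigr => U _; rewrite mem_set.
Qed.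

End Isomorphism.

Lemma cs_hom_comp (R : realType) (C D E : cstarAlgebra R) (phi : C -> D) (psi : D -> E) :
  cs_hom phi -> cs_hom psi -> cs_hom (psi \o phi).
Proof.
move=> [l1 m1 s1] [l2 m2 s2]; split => [k a b|a b|a] /=.
- by rewrite l1 l2.
- by rewrite m1 m2.
- by rewrite s1 s2.
Qed.

Lemma cs_hom_star_hom (R : realType) (A : starSubquotient R) (D E : cstarAlgebra R)
    (iota : sq_car A -> D) (psi : D -> E) :
  star_hom iota -> cs_hom psi -> star_hom (psi \o iota).
Proof.
move=> [l1 m1 s1 n1] [l2 m2 s2]; split => [k a b Aa Ab|a b Aa Ab|a Aa|a Na] /=.
- by rewrite l1 // l2.
- by rewrite m1 // m2.
- by rewrite s1 // s2.
- have := l2 (-1) 0 0; rewrite n1 // scaler0 addr0 scaleN1r addNr; exact.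
Qed.

(** The uniqueness part of the universal property. *)
Lemma enveloping_id (R : realType) (A : starSubquotient R) (E : cstarAlgebra R)
    (iota : sq_car A -> E) (psi : E -> E) : enveloping iota -> cs_hom psi ->
  (forall a, sq_sub a -> psi (iota a) = iota a) -> psi =1 id.
Proof.
move=> [iotaP univ] psiP psi_id x.
have [h [_ uniq_h]] := univ E iota iotaP.
have idP : cs_hom (id : E -> E) by split.
by rewrite -(uniq_h psi (conj psiP psi_id)) (uniq_h id (conj idP (fun _ _ => erefl))).
Qed.

Unset Implicit Arguments.

Theorem theorem2p15 (R : realType) (G : etaleGroupoid) (B : fellBundle R G)
    (S : set (set G)) (S_inv : inverse_subsemigroup S) (S_wide : wide S)
    (hyp : hausdorff_space G \/
           (@second_countable G /\ forall U, S U -> C0_separable B U))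
    (EA : cstarAlgebra R) (iotaA : sq_car (CcA_mod_I B S) -> EA)
    (envA : enveloping iotaA)
    (EB : cstarAlgebra R) (iotaB : sq_car (CcB_alg B) -> EB)
    (envB : enveloping iotaB) :
  exists Phi : EA -> EB, cs_iso Phi /\
    forall f, CcA0 B S f -> Phi (iotaA f) = iotaB (Psi f).
Proof.
have [homA univA] := envA; have [homB univB] := envB.
pose TA U s := iotaA (delta U s).
have TA_rep : bundle_rep false S TA := star_hom_rep S_inv homA.
have TA_rep' := bundle_rep_sub TA_rep.
have TB_rep : bundle_rep true S (fun _ s => iotaB s) := CcB_bundle_rep S_inv homB.
have [TB TB_ext TB_E] := rep_extend S_inv TB_rep.
have [Phi [[Phi_hom PhiE] _]] := univA _ _ (formal_rep_hom S_inv TB_ext).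
have [Phi' [[Phi'_hom Phi'E] _]] := univB _ _ (rep_fun_hom S_inv S_wide TA_rep').
have Phi_delta U s : S U -> asec true U s -> Phi (TA U s) = iotaB s.
  move=> SU sU; rewrite /TA PhiE; last by apply: CcA_delta => //; exact: asec_sub.
  by rewrite (formal_rep_delta TB_ext) // TB_E.
have Phi'_Cc U s : S U -> asec true U s -> Phi' (iotaB s) = TA U s.
  move=> SU sU; rewrite Phi'E; last exact: (CcB_slice S_inv SU).
  by apply: rep_funP => //; exact: rep_val_one.
have iotaB0 : iotaB 0 = 0 by have [_ _ _] := homB; exact.
have iotaBD p q : CcB B p -> CcB B q -> iotaB (p + q) = iotaB p + iotaB q.
  by have [lin _ _ _] := homB => pC qC; have := lin 1 p q pC qC; rewrite !scale1r.
(* [Phi' \o Phi \o iotaA] and [iotaA] agree on compactly supported sections, hence,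
   both being bounded, on all sections. *)
have Phi'K : Phi' \o Phi =1 id.
  apply: (enveloping_id envA); first exact: cs_hom_comp.
  move=> f fC /=.
  have hom2 := cs_hom_star_hom homA (cs_hom_comp Phi_hom Phi'_hom).
  have /(rep_dense_eq S_inv (star_hom_rep S_inv hom2) TA_rep) eqT :
      forall U s, S U -> asec true U s -> (Phi' \o Phi \o iotaA) (delta U s) = TA U s.
    by move=> U s SU sU /=; rewrite -/(TA U s) Phi_delta // (Phi'_Cc U).
  rewrite -[LHS]/((Phi' \o Phi \o iotaA) f) (star_hom_formal_rep S_inv hom2 fC).
  rewrite (star_hom_formal_rep S_inv homA fC); apply: eq_fsbigr => U /set_mem SU.
  by have /(CcA_P S_inv)[_ fS _] := fC; exact: eqT (fS U SU).
have PhiK : Phi \o Phi' =1 id.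
  apply: (enveloping_id envB); first exact: cs_hom_comp.
  move=> p pC /=; rewrite Phi'E //.
  have [d pd] := rep_val_CcB S_inv S_wide TA_rep' pC.
  rewrite (rep_funP S_inv S_wide TA_rep' pd).
  have [lin _ _] := Phi_hom.
  suff [] : CcB B p /\ Phi d = iotaB p by [].
  move: p d pd {pC}; apply: rep_val_ind => [|U s p d SU sU _ [pC pE]].
    split; first exact: CcB0.
    by rewrite iotaB0; have := lin (-1) 0 0; rewrite scaler0 addr0 scaleN1r addNr.
  have sC := CcB_slice S_inv SU sU; split; first exact: CcBD.
  by have := lin 1 (TA U s) d; rewrite !scale1r => ->; rewrite iotaBD // Phi_delta // pE.
exists Phi; split; first by split => //; exists Phi'.
move=> f f0C; rewrite PhiE; last exact: (CcA0_CcA S_inv).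
have /(CcA0_P S_inv)[ff fS f0] := f0C; have [r [ur rS rf]] := formal_suppP ff f0.
rewrite (formal_repE TB_ext ur rS rf) (PsiE ur rf).
suff [] : CcB B (\sum_(U <- r) f U) /\
  \sum_(U <- r) TB U (f U) = iotaB (\sum_(U <- r) f U) by [].
elim: r {ur rf} rS => [|U r IH] rS; first by rewrite !big_nil; split => //; exact: CcB0.
have [|rC rE] := IH; first by move=> V Vr; apply: rS; rewrite /= in_cons Vr orbT.
have SU : S U by apply: rS; rewrite /= mem_head.
have UC := CcB_slice S_inv SU (fS U SU); rewrite !big_cons; split; first exact: CcBD.
by rewrite iotaBD // rE TB_E //; exact: fS.
Qed.
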